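(* There is a deterministic read-only online algorithm that solves the Circular Pattern Matching problem on a pattern $P$ of length $m$ and a text $T$ of length $n$ using $O(1)$ space and $O(1)$ time per letter of the text.
   Context: Circular Pattern Matching: report all occurrences in $T$ of rotations of $P$, where a rotation of $P$ is $P[\Delta+1\mathinner{.\,.} m]P[1\mathinner{.\,.}\Delta]$ for some $\Delta\in[1\mathinner{.\,.} m]$. Read-only: the algorithm has random read-only access to $P$ and $T$ and the space bound counts only extra space beyond the input. Online: the text is processed letter by letter and every occurrence is reported as soon as its last letter has been read. Integer alphabet of size polynomial in the input length; word RAM model. *)

(* Defs.v *)
From mathcomp Require Import all_boot.

Set Implicit Arguments.
Unset Strict Implicit.
Unset Printing Implicit Defensive.

(** * Circular pattern matching

    Strings are sequences of letters in [nat], and positions count from 0.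
    [rot D P = drop D P ++ take D P] is the rotation P[D+1..m]P[1..D]. *)

Definition is_rotation (P X : seq nat) : bool :=
  has (fun D => X == rot D P) (iota 1 (size P)).

Definition circ_occ (P T : seq nat) (s : nat) : bool :=
  (s + size P <= size T) && is_rotation P (take (size P) (drop s T)).

(** Starting positions of the occurrences whose last letter is the [i]-th
    letter of [T]; there is at most one. *)
Definition circ_occ_ending (P T : seq nat) (i : nat) : seq nat :=
  [seq s <- iota 0 i | (s + size P == i) && circ_occ P T s].

(** * Online word RAM with read-only input

    The working memory is an array of [w]-bit words, all initially 0, addressed
    directly ([Dir a] is cell [a]) or indirectly ([Ind a] is the cell whose
    address is stored in cell [a]). Pattern and text are not in that memory and
    can only be read. *)

Inductive loc := Dir of nat | Ind of nat.

Inductive operand := Imm of nat | Val of loc.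

Inductive binop :=
  OAdd | OSub | OMul | ODiv | OMod | OAnd | OOr | OXor | OShl | OShr | OEq | OLt.

Inductive instr :=
  | Op of binop & loc & operand & operand
  | ReadP of loc & operand  (* letter of the pattern at a given position *)
  | ReadT of loc & operand  (* letter of the text at a given position *)
  | LenP of loc             (* length of the pattern *)
  | LenT of loc             (* number of text letters that have arrived *)
  | Jz of operand & nat     (* jump if the operand is zero *)
  | Report of operand
  | Await.                  (* wait for the next letter of the text *)

Definition program := seq instr.

(** [space] is the number of words of working memory used so far: one more than
    the largest address accessed. [reports] lists the values reported since
    the arrival of the current letter; this output is write-only. *)
Record conf := Conf {
  pc : nat;
  mem : nat -> nat;
  space : nat;
  waiting : bool;
  reports : seq nat
}.

Definition init : conf := Conf 0 (fun=> 0) 0 true [::].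

Section Semantics.

Variable w : nat.

Definition trunc (x : nat) : nat := x %% 2 ^ w.

(** The operands are smaller than [2 ^ w]; subtraction wraps around. *)
Definition eval_binop (o : binop) (x y : nat) : nat :=
  trunc match o with
  | OAdd => x + y
  | OSub => x + (2 ^ w - y)
  | OMul => x * y
  | ODiv => x %/ y
  | OMod => x %% y
  | OAnd => Nat.land x y
  | OOr => Nat.lor x y
  | OXor => Nat.lxor x y
  | OShl => x * 2 ^ y
  | OShr => x %/ 2 ^ y
  | OEq => x == y
  | OLt => x < y
  end.

Definition addr (M : nat -> nat) (l : loc) : nat :=
  match l with Dir a => a | Ind a => M a end.

Definition eval (M : nat -> nat) (x : operand) : nat :=
  match x with Imm k => trunc k | Val l => M (addr M l) end.

Definition loc_space (M : nat -> nat) (l : loc) : nat :=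
  match l with Dir a => a.+1 | Ind a => maxn a.+1 (M a).+1 end.

Definition operand_space (M : nat -> nat) (x : operand) : nat :=
  match x with Imm _ => 0 | Val l => loc_space M l end.

Definition instr_space (M : nat -> nat) (i : instr) : nat :=
  match i with
  | Op _ d x y =>
      maxn (loc_space M d) (maxn (operand_space M x) (operand_space M y))
  | ReadP d x | ReadT d x => maxn (loc_space M d) (operand_space M x)
  | LenP d | LenT d => loc_space M d
  | Jz x _ | Report x => operand_space M x
  | Await => 0
  end.

Definition write (M : nat -> nat) (d : loc) (v : nat) : nat -> nat :=
  let a := addr M d in fun b => if b == a then trunc v else M b.

(** One unit-cost step, where [T] is the part of the text that has arrived.
    A read outside of [P] or of [T] yields 0. *)
Definition step (A : program) (P T : seq nat) (s : conf) : conf :=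
  if waiting s then s else
  let M := mem s in
  let i := nth Await A (pc s) in
  let sp := maxn (space s) (instr_space M i) in
  let set d v := Conf (pc s).+1 (write M d v) sp false (reports s) in
  match i with
  | Op o d x y => set d (eval_binop o (eval M x) (eval M y))
  | ReadP d x => set d (nth 0 P (eval M x))
  | ReadT d x => set d (nth 0 T (eval M x))
  | LenP d => set d (size P)
  | LenT d => set d (size T)
  | Jz x l =>
      Conf (if eval M x == 0 then l else (pc s).+1) M sp false (reports s)
  | Report x => Conf (pc s).+1 M sp false (rcons (reports s) (eval M x))
  | Await => Conf (pc s).+1 M sp true (reports s)
  end.

Definition deliver (s : conf) : conf :=
  Conf (pc s) (mem s) (space s) false [::].

(** Configuration after [i] letters of [T] have arrived, with [t] steps allowed
    for each of them. No step is taken before the first letter, and a step of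
    a waiting machine does nothing, so the time bound [t] is respected iff
    the machine is waiting in each of these configurations. *)
Fixpoint run (A : program) (P T : seq nat) (t i : nat) : conf :=
  if i is j.+1 then
    iter t (step A P (take i T)) (deliver (run A P T t j))
  else init.

Definition online_circ_matching (A : program) (P T : seq nat) (t sp : nat) :=
  forall i, 0 < i <= size T ->
    let s := run A P T t i in
    [/\ waiting s, space s <= sp & reports s = circ_occ_ending P T i].

End Semantics.

(* Main.v *)
Require Import Defs.
From Stdlib Require Import Classical.
From Stdlib Require PeanoNat.
From mathcomp Require Import all_boot zify.

Set Implicit Arguments.
Unset Strict Implicit.
Unset Printing Implicit Defensive.

(** Let [m = |P|] and [B = m / 8].  The text is cut into blocks of [B] letters.
    All windows that end in a given block share a core [C] of [m - 2B] letters,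
    which is known [B] letters before the block starts.  During those [B] letters
    a job finds, in O(m) steps, all alignments of [C] in [P^omega].  It searches for
    [C] in the manner of Crochemore and Perrin: the critical cut of [C] is the
    later of its maximal suffixes for the two opposite orders, and comparing
    outwards from the cut in both directions at once makes every mismatch after
    [j] comparisons pay for a shift by [j + 1], so no period of [C] is needed.
    Either all alignments read the same letters, or they are at distance
    [q <= m / 2]; in the second case they form an arithmetic progression inside one
    [q]-periodic run of [P^omega], and a window is matched by aligning a break of
    the [q]-run of the text with a break of the run of [P^omega], or, when the
    window has no break, by its phase.  The remaining letters of the windows are
    compared as they arrive.  Two jobs, shifted by [B], take turns. *)

(** * Maximal suffixes and critical cuts *)

(** With O(1) words neither a failure function nor the list of alignments of the core can be stored,
    and with O(1) steps per letter no search may run to its end while a letter waits. Every search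
    is therefore a resumable state in 22 registers, and each letter advances it by a fixed number of
    iterations of loop-free code, so that the time bound is the length of the program.

    The fraction 1/8 comes from [occurs_run]: an occurrence at distance [d > L] from [A0], moved
    back by [m], must still share [q] letters with the run, that is [m + q <= d + L]; since [2 * L]
    is at least [3m/2], this holds for every [q <= m/2]. Patterns of fewer than 8 letters, for which
    [B] would be 0, are matched by a fixed number of comparisons. *)

Section MaximalSuffix.

Variables (c : nat -> nat) (L : nat).

Definition letter_lt (o : bool) (x y : nat) := if o then y < x else x < y.

(** A proper prefix is the smaller string for both letter orders, so the two suffix orders are not
    converse to each other. *)
Definition suffix_lt o s t := exists k,
  [/\ forall k', k' < k -> c (s + k') = c (t + k'), t + k < L &
      s + k = L \/ (s + k < L /\ letter_lt o (c (s + k)) (c (t + k)))].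

Definition max_suffix o a := a < L /\ forall s, s < L -> ~ suffix_lt o a s.

Lemma suffix_lt_irr o s : ~ suffix_lt o s s.
Proof. by case=> k [_ h1 h2]; rewrite /letter_lt in h2; case: o h2; lia. Qed.

Lemma suffix_lt_trans o s t u :
  suffix_lt o s t -> suffix_lt o t u -> suffix_lt o s u.
Proof.
move=> [k [ek tk hk]] [l [el ul hl]].
have [lt_kl|lt_lk|eq_kl] := ltngtP k l.
- exists k; split; [|lia|].
  + by move=> k' h; rewrite ek // el //; lia.
  + by rewrite -el.
- exists l; split => //.
  + by move=> k' h; rewrite ek ?el //; lia.
  + by rewrite ek //; right; lia.
- subst l; exists k; split => //.
  + by move=> k' h; rewrite ek ?el //; lia.
  + by move: hk hl; rewrite /letter_lt; case: o; lia.
Qed.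

Lemma suffix_lt_total o s t : s < L -> t < L -> s != t ->
  suffix_lt o s t \/ suffix_lt o t s.
Proof.
move=> sL tL st.
pose Q k := [|| L <= s + k, L <= t + k | c (s + k) != c (t + k)].
have exQ : exists k, Q k by exists L; rewrite /Q; lia.
case: (ex_minnP exQ) => k Qk mink.
have below k' : k' < k -> [/\ s + k' < L, t + k' < L & c (s + k') = c (t + k')].
  move=> h; have : ~~ Q k' by apply/negP => /mink; lia.
  by rewrite /Q !negb_or => /and3P[h1 h2 /negPn/eqP h3]; split => //; lia.
have prev : k = 0 \/ s + k <= L /\ t + k <= L.
  case: (k) below => [|k1] below; first by left.
  by right; have [] := below k1 (ltnSn _); lia.
case: (ltnP (s + k) L) => hs; last first.
  by left; exists k; split; [move=> k' /below[] | lia | lia].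
case: (ltnP (t + k) L) => ht; last first.
  by right; exists k; split; [move=> k' /below[] // | lia | lia].
have ne : c (s + k) != c (t + k) by move: Qk; rewrite /Q; lia.
case: (boolP (letter_lt o (c (s + k)) (c (t + k)))) => h.
  by left; exists k; split; [move=> k' /below[] | lia | right].
right; exists k; split; [by move=> k' /below[] | lia | right; split => //].
by move: h; rewrite /letter_lt; case: o; lia.
Qed.

Lemma suffix_lt_shift o s t k u : u <= k ->
  (forall k', k' < k -> c (s + k') = c (t + k')) -> t + k < L ->
  s + k = L \/ s + k < L /\ letter_lt o (c (s + k)) (c (t + k)) ->
  suffix_lt o (s + u) (t + u).
Proof.
move=> uk e tk h; exists (k - u).
have -> : s + u + (k - u) = s + k by lia.
have -> : t + u + (k - u) = t + k by lia.
split => // k' h'; have := e (u + k'); rewrite !addnA; apply; lia.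
Qed.

(** The dominating suffix may start anywhere, even at a start already rejected or not yet reached;
    this is what lets the loop do without a period of the candidate. *)
Definition dominated o s := exists2 t, t < L & suffix_lt o s t.

(** The order is irreflexive and transitive on finitely many suffixes, so one of them is
    undominated, and it can only be [a]. Chains of dominations never have to be followed. *)
Lemma max_suffix_undominated o a : a < L ->
  (forall s, s < L -> s != a -> dominated o s) -> max_suffix o a.
Proof.
move=> aL H.
have ex n : 0 < n <= L ->
    exists2 b, b < L & forall s, s < n -> ~ suffix_lt o b s.
  elim: n => // n IHn hn; case: n IHn hn => [|n] IHn hn.
    exists 0; first lia.
    move=> s s1; have -> : s = 0 by lia.
    exact: suffix_lt_irr.
  case: IHn => [|b bL hb]; first lia.
  have [hbn|hbn] := classic (suffix_lt o b n.+1); last first.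
    by exists b => // s; rewrite ltnS leq_eqVlt => /orP[/eqP->|/hb].
  exists n.+1; first lia.
  move=> s; rewrite ltnS leq_eqVlt => /orP[/eqP->|h]; first exact: suffix_lt_irr.
  by move=> h'; apply: (hb s h); apply: suffix_lt_trans h'.
case: (ex L) => [|b bL hb]; first lia.
split => //; case: (eqVneq b a) => [<- //|ba].
by case: (H b bL ba) => t tL bt; case: (hb t tL).
Qed.

(** The premise says that [d] is a local period at the cut [x]. Besides being a global period, [d]
    is required to exceed the left part, which settles the mismatches found on the left. *)
Definition crit_cut (x : nat) := forall d, 0 < d ->
  (forall k, k < d -> d <= x + k -> x + k < L -> c (x + k) = c (x + k - d)) ->
  x < d /\ forall t, t + d < L -> c t = c (t + d).

(* Crochemore and Perrin's critical factorization theorem.  The maximal suffix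
   for one order excludes the local periods that fit into the left part; the
   maximal suffix for the opposite order starts no later, which turns a first
   mismatch into a contradiction. *)
Lemma crit_cut_max_suffixes o a1 a2 : a2 <= a1 ->
  max_suffix o a1 -> max_suffix (~~ o) a2 -> crit_cut a1.
Proof.
move=> a21 [a1L m1] [a2L m2] d d0 rep.
have noshort : a1 < d.
  (* The suffixes at [a1 - d] and [a1] share [d] letters and go on as the suffixes at [a1] and
     [a1 + d]; if the latter is smaller than [a1], then [a1] is smaller than [a1 - d]. A right part
     of at most [d] letters is a proper prefix of the suffix at [a1 - d]. *)
  rewrite ltnNge; apply/negP => dle.
  case: (leqP (L - a1) d) => hL.
    apply: (m1 (a1 - d)); first lia.
    exists (L - a1); split; [|lia|left; lia].
    by move=> k' h; rewrite rep; [congr (c _); lia|lia|lia|lia].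
  have [h|h] := @suffix_lt_total o (a1 + d) a1 ltac:(lia) ltac:(lia) ltac:(lia).
    case: h => k [ek kL hk]; apply: (m1 (a1 - d)); first lia.
    exists (d + k); split; [|lia|].
    - move=> k' h; case: (ltnP k' d) => h'.
        by rewrite rep; [congr (c _); lia|lia|lia|lia].
      have := ek (k' - d) ltac:(lia).
      have -> : a1 + d + (k' - d) = a1 + k' by lia.
      by move=> ->; congr (c _); lia.
    - have -> : a1 - d + (d + k) = a1 + k by lia.
      by rewrite addnA.
  by apply: (m1 (a1 + d)) h; lia.
split => //.
have small t : t < a1 -> t + d < L -> c t = c (t + d).
  move=> h1 h2; have := rep (t + d - a1).
  have -> : a1 + (t + d - a1) = t + d by lia.
  by rewrite addnK => <- //; lia.
case: (leqP (L - a1) d) => hL; first by move=> t h; apply: small; lia.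
have [h|h] := @suffix_lt_total o (a1 + d) a1 ltac:(lia) ltac:(lia) ltac:(lia); last first.
  by case: (m1 (a1 + d)) => //; lia.
case: h => k [ek kL [hk|[hk1 hk2]]].
  move=> t ht; case: (ltnP t a1) => h; first exact: small.
  have := ek (t - a1) ltac:(lia).
  have -> : a1 + d + (t - a1) = t + d by lia.
  by rewrite subnKC.
(* The mismatch of [a1 + d] with [a1], reached from [a2 <= a1] through equal letters, has the
   opposite sense in the other order. *)
case: (m2 (a2 + d)); first lia.
exists (a1 - a2 + k); split; [|lia|].
- move=> k' h; case: (ltnP k' (a1 - a2)) => h'.
    have -> : a2 + d + k' = a2 + k' + d by lia.
    by apply: small; lia.
  have := ek (k' - (a1 - a2)) ltac:(lia).
  have -> : a1 + d + (k' - (a1 - a2)) = a2 + d + k' by lia.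
  by move=> ->; congr (c _); lia.
- right; have -> : a2 + (a1 - a2 + k) = a1 + k by lia.
  have -> : a2 + d + (a1 - a2 + k) = a1 + d + k by lia.
  by split; [lia | move: hk2; rewrite /letter_lt; case: (o)].
Qed.

Lemma crit_cut_maxn a1 a2 :
  max_suffix false a1 -> max_suffix true a2 -> crit_cut (maxn a1 a2).
Proof.
move=> h1 h2; case: (leqP a2 a1) => h.
  by apply: (crit_cut_max_suffixes (o := false) (a2 := a2)).
by apply: (crit_cut_max_suffixes (o := true) (a2 := a1)) => //; lia.
Qed.

Definition occurs (Y : nat -> nat) p := forall t, t < L -> Y (p + t) = c t.

(** With the [j] letters matched right of the cut, an occurrence at [p + d] makes [d] a local
    period. Then [x < d <= j] rules out a mismatch on the left, and the global period [d] turns the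
    occurrence into a match at the mismatch on the right. *)
Lemma crit_cut_shift (Y : nat -> nat) x p j : crit_cut x ->
  (forall k, k < j -> x + k < L -> Y (p + x + k) = c (x + k)) ->
  x <= L ->
  (x + j < L /\ Y (p + x + j) <> c (x + j)) \/
  (j < x /\ Y (p + x - 1 - j) <> c (x - 1 - j)) ->
  forall d, d <= j -> ~ occurs Y (p + d).
Proof.
move=> cx ev xL bad d dj oc.
case: (posnP d) => d0.
  subst d; rewrite addn0 in oc; case: bad => [][h]; case.
    by rewrite -addnA oc.
  by rewrite -(oc (x - 1 - j)); [congr (Y _)|]; lia.
case: (cx d d0) => [k kd h1 h2|xd per].
  rewrite -ev //; last lia.
  rewrite -(oc (x + k - d)); last lia.
  by congr (Y _); lia.
case: bad => [][h]; last by lia.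
case; rewrite -(_ : x + j - d + d = x + j); last lia.
rewrite -per; last lia.
rewrite -(oc (x + j - d)); last lia.
by congr (Y _); lia.
Qed.

End MaximalSuffix.

(** * Alignments of the core *)

Definition periodic_on (f : nat -> nat) q lo hi :=
  forall t, lo <= t -> t + q < hi -> f t = f (t + q).

Lemma periodic_onS f q lo hi lo' hi' : lo <= lo' -> hi' <= hi ->
  periodic_on f q lo hi -> periodic_on f q lo' hi'.
Proof. by move=> h1 h2 h t lt ht; apply: h; lia. Qed.

Lemma periodic_on_mul f q lo hi n t : periodic_on f q lo hi -> lo <= t ->
  t + n * q < hi -> f t = f (t + n * q).
Proof.
move=> h; elim: n t => [|n IHn] t lt ht; first by rewrite mul0n addn0.
rewrite mulSn in ht *; rewrite (h t) //; last lia.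
by rewrite (IHn (t + q)) -?addnA //; lia.
Qed.

(** The common letters contain a full period, which determines both functions throughout their runs.
    This replaces the comparison of letters that the program never compares. *)
Lemma periodic_on_agree (f g : nat -> nat) q L x a lo1 hi1 lo2 hi2 :
  0 < q <= L ->
  periodic_on f q lo1 hi1 -> lo1 <= x -> x + L <= hi1 ->
  periodic_on g q lo2 hi2 -> lo2 <= a -> a + L <= hi2 ->
  (forall t, t < L -> f (x + t) = g (a + t)) ->
  forall u, lo1 <= u < hi1 -> lo2 + x <= a + u < hi2 + x ->
  f u = g (a + u - x).
Proof.
move=> qL pf l1 h1 pg l2 h2 e.
have right u : x <= u < hi1 -> a + u < hi2 + x -> f u = g (a + u - x).
  elim/ltn_ind: u => u IHu hu hu'.
  case: (ltnP u (x + L)) => hL.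
    by have := e (u - x) ltac:(lia); rewrite subnKC; [move=> ->; congr g|]; lia.
  have := IHu (u - q) ltac:(lia) ltac:(lia) ltac:(lia).
  have -> : f u = f (u - q) by rewrite (pf (u - q)); [congr f|..]; lia.
  by move=> ->; rewrite pg; [congr g|..]; lia.
have left n : forall u, x - u <= n -> lo1 <= u -> u < hi1 ->
    lo2 + x <= a + u -> a + u < hi2 + x -> f u = g (a + u - x).
  elim: n => [|n IHn] u hn u1 u2 u3 u4; first by apply: right; lia.
  case: (leqP x u) => hx; first by apply: right; lia.
  rewrite pf; [|lia|lia].
  have -> : g (a + u - x) = g (a + (u + q) - x) by rewrite pg; [congr g|..]; lia.
  by apply: IHn; lia.
by move=> u hu hu'; apply: (left (x - u)); lia.
Qed.

(* A wrapper that hides remainders from [lia]. *)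
Definition eqmod d a b : Prop := a = b %[mod d].

Lemma eqmod_le d a b : 0 < d -> eqmod d a b -> a <= b -> exists n, b = a + n * d.
Proof.
move=> d0 E ab; exists ((b - a) %/ d); rewrite divnK ?subnKC //.
by rewrite -eqn_mod_dvd //; apply/eqP.
Qed.

Lemma ex_divn_eq d b : 0 < d -> exists n s, b = n * d + s /\ s < d.
Proof. by move=> d0; exists (b %/ d), (b %% d); rewrite -divn_eq ltn_pmod. Qed.

Lemma eqmodMDl d n a : eqmod d (a + n * d) a.
Proof. by rewrite /eqmod addnC modnMDl. Qed.

Section Alignments.

Variables (m B L : nat) (Y Tt : nat -> nat) (X : nat).
Hypothesis (m8 : 8 * B <= m) (m_gt0 : 0 < m) (defL : L = m - 2 * B).
Hypothesis Yper : forall t, Y (t + m) = Y t.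

Let c t := Tt (X + t).
Notation occ := (occurs c L Y).

Definition cyclic_window e := exists a, forall t, t < m -> Tt (e + t) = Y (a + t).

Lemma cyclic_fun_modn s t : s = t %[mod m] -> Y s = Y t.
Proof.
have Ymul u n : Y (u + n * m) = Y u.
  by elim: n => [|n IHn]; rewrite ?mul0n ?addn0 // mulSnr addnA Yper.
move=> e; rewrite (divn_eq s m) (divn_eq t m) e.
by rewrite ![_ * m + _]addnC !Ymul.
Qed.

Lemma occurs_modn a b : a = b %[mod m] -> occ a -> occ b.
Proof.
move=> e oa t tL; rewrite -oa //; apply: cyclic_fun_modn.
by rewrite -modnDml -e modnDml.
Qed.

Lemma occursDm a : occ (a + m) <-> occ a.
Proof. by split; apply: occurs_modn; rewrite modnDr. Qed.

Lemma cyclic_window_occurs e a : e <= X -> X + L <= e + m ->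
  (forall t, t < m -> Tt (e + t) = Y (a + t)) -> occ (a + (X - e)).
Proof.
move=> h1 h2 h t tL; have := h (X - e + t) ltac:(lia).
by rewrite /c => e1; rewrite -addnA -e1; congr Tt; lia.
Qed.

(** [A] is the position of [P^omega] placed under the start [X] of the core, so alignments and
    occurrences of the core are the same numbers. *)
Definition aligned A lo hi := forall u, lo <= u < hi -> Tt u = Y (A + u - X).

Lemma aligned_window A e : X <= A + e -> aligned A e (e + m) -> cyclic_window e.
Proof.
move=> h al; exists (A + e - X) => t tm; rewrite al; last lia.
by congr Y; lia.
Qed.

Lemma aligned_window_unique A e : X <= A + e -> e <= X -> X + L <= e + m ->
  (forall b, occ b -> forall t, Y (b + t) = Y (A + t)) ->
  X - e <= m -> m <= A ->
  cyclic_window e -> aligned A e (e + m).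
Proof.
move=> h1 h2 h3 un h4 h5 [a Ha] u hu.
have oa := cyclic_window_occurs h2 h3 Ha.
have := Ha (u - e) ltac:(lia); rewrite subnKC; last lia.
(* Letters before the core have negative offsets from the occurrence; adding a period makes the
   offsets natural numbers. *)
move=> ->; rewrite -(Yper (A + u - X)) -[LHS]Yper.
have E := un _ oa (m + (u - e) - (X - e)).
have -> : a + (u - e) + m = a + (X - e) + (m + (u - e) - (X - e)) by lia.
by rewrite E; congr Y; lia.
Qed.

(** [A0] and [A0 + q] are consecutive alignments of the core, and [[al, be)] is the maximal
    [q]-periodic run of [P^omega] around them. [2 * m <= A0] leaves room to move left in [nat]. *)
Variables (q A0 al be : nat).
Hypotheses (q_gt0 : 0 < q) (qm : 2 * q <= m).
Hypotheses (oc0 : occ A0) (oc1 : occ (A0 + q))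
  (ocN : forall s, 0 < s < q -> ~ occ (A0 + s)).
Hypotheses (A0m : 2 * m <= A0).
Hypothesis run : periodic_on Y q al be.
Hypotheses (al_gt : A0 < al + m) (alA0 : al <= A0) (be_gt : A0 + q + L <= be).
Hypotheses (brk_al : Y al.-1 <> Y (al.-1 + q)) (brk_be : Y (be - q) <> Y be).

Lemma core_periodic : periodic_on c q 0 L.
Proof.
move=> t _ h; rewrite -(oc0 (t := t + q)) // -(oc1 (t := t)); last lia.
by congr Y; lia.
Qed.

Lemma occurs_periodic a : occ a -> periodic_on Y q a (a + L).
Proof.
move=> oa t h1 h2; have := core_periodic (t := t - a) ltac:(lia) ltac:(lia).
rewrite -!oa; [|lia|lia]; rewrite subnKC // => ->.
by congr Y; lia.
Qed.

Lemma occurs_in_run a : al <= a -> a + L <= be -> eqmod q a A0 -> occ a.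
Proof.
move=> h1 h2 h3 t tL; rewrite -(oc0 tL).
case: (leqP a A0) => h.
  have [n hn] := eqmod_le q_gt0 h3 h.
  by rewrite hn addnAC; apply: periodic_on_mul run _ _; lia.
have [n hn] := eqmod_le q_gt0 (esym h3) (ltnW h).
by rewrite hn addnAC; symmetry; apply: periodic_on_mul run _ _; lia.
Qed.

(** Sharing [q] letters with the run, an interval reaching past one of its ends would contain both
    letters of the break there. *)
Lemma run_max lo hi s : periodic_on Y q lo hi -> lo <= s -> s + q <= hi ->
  al <= s -> s + q <= be -> al <= lo /\ hi <= be.
Proof.
move=> p h1 h2 h3 h4; split; rewrite leqNgt; apply/negP => h.
  by case: brk_al; apply: p; lia.
by case: brk_be; rewrite p; [congr Y|..]; lia.
Qed.

(* The core has two overlapping occurrences at distance q <= m/2, and is so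
   long that any other occurrence overlaps their union, or its translate by m,
   in at least q letters; hence all occurrences lie in one run modulo m. *)
Lemma occurs_run a : occ a -> exists b,
  [/\ eqmod m b a, al <= b, b + L <= be & eqmod q b A0].
Proof.
move=> oa.
have [d [dm E]] : exists d, d < m /\ eqmod m (A0 + d) a.
  exists ((a + A0 * m - A0) %% m); rewrite ltn_pmod // /eqmod modnDmr; split => //.
  have h : A0 <= A0 * m by rewrite leq_pmulr.
  by rewrite subnKC ?(leq_trans h) ?leq_addl // addnC modnMDl.
have ob : occ (A0 + d) by apply: occurs_modn oa; rewrite E.
have pA : periodic_on Y q A0 (A0 + q + L) by apply: periodic_onS run; lia.
case: (leqP d L) => hd.
  have p1 : periodic_on Y q A0 (A0 + d + L).
    move=> t h1 h2; case: (ltnP (t + q) (A0 + q + L)) => h; first exact: pA.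
    by apply: (occurs_periodic ob); lia.
  have [_ hbe] := run_max p1 (s := A0) ltac:(lia) ltac:(lia) ltac:(lia) ltac:(lia).
  exists (A0 + d); split => //; first lia.
  have [n [s [hs sq]]] := ex_divn_eq d q_gt0.
  (* Periodicity moves the occurrence back to the remainder of its distance modulo [q], and no
     distance strictly between 0 and [q] is possible. *)
  have os : occ (A0 + s).
    move=> t tL; rewrite (periodic_on_mul (n := n) p1); [|lia|lia].
    by rewrite -(ob t tL); congr Y; lia.
  have s0 : s = 0 by case: (posnP s) => // s0; case: (@ocN s) => //; lia.
  by rewrite hs s0 addn0; apply: eqmodMDl.
have hq : q + m <= d + L by lia.
have [b hb] : exists b, b + m = A0 + d by exists (A0 + d - m); lia.
have Eb : eqmod m b a by rewrite /eqmod -E -hb modnDr.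
have ob' : occ b by apply: occurs_modn oa.
have p1 : periodic_on Y q b (A0 + q + L).
  move=> t h1 h2; case: (leqP A0 t) => h; first exact: pA.
  by apply: (occurs_periodic ob'); lia.
have [hal _] := run_max p1 (s := A0) ltac:(lia) ltac:(lia) ltac:(lia) ltac:(lia).
exists b; split => //; first lia.
have [n [s [hs sq]]] := ex_divn_eq (m - d) q_gt0.
case: (posnP s) => s0.
  have -> : A0 = b + n * q by lia.
  by rewrite /eqmod addnC modnMDl.
case: (@ocN (q - s)); first lia.
move=> t tL; rewrite -(ob' t tL) [RHS](periodic_on_mul (n := n.+1) p1);
  [congr Y|..]; lia.
Qed.

Variable (e : nat).
Hypotheses (eX : e <= X) (Xe : X - e < B).

Lemma window_run : cyclic_window e -> exists b,
  [/\ aligned b e (e + m), al <= b, b + L <= be & eqmod q b A0].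
Proof.
move=> [a Ha].
have [|b [h1 h2 h3 h4]] := occurs_run (cyclic_window_occurs eX _ Ha); first lia.
exists b; split => // u hu.
have := Ha (u - e) ltac:(lia); rewrite subnKC; last lia.
move=> ->; apply: cyclic_fun_modn; rewrite -(modnDr (a + _)) -(modnDr (_ - _)).
have -> : a + (u - e) + m = a + (X - e) + (u - e + m - (X - e)) by lia.
have -> : b + u - X + m = b + (u - e + m - (X - e)) by lia.
by rewrite -modnDml -h1 modnDml.
Qed.

Lemma aligned_periodic b lo hi lo' hi' :
  aligned b lo hi -> X <= b + lo ->
  (periodic_on Tt q lo' hi' -> lo <= lo' -> hi' <= hi ->
   periodic_on Y q (b + lo' - X) (b + hi' - X)).
Proof.
move=> ab h0 p h1 h2 t ht1 ht2.
have := p (t + X - b) ltac:(lia) ltac:(lia).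
rewrite !ab; [|lia|lia].
have -> : b + (t + X - b) - X = t by lia.
by move=> ->; congr Y; lia.
Qed.

(** In a match the image of the text run lies in the run of [P^omega], so it cannot start before
    [al]; if it started later, the break at [r - 1] would fall inside the run. Only the alignment
    with [al] under [r] remains. *)
Lemma window_left_break r : e < r <= X -> Tt r.-1 <> Tt (r.-1 + q) ->
  periodic_on Tt q r (X + L) ->
  cyclic_window e <-> aligned (al + X - r) e (e + m).
Proof.
move=> er brk p; split; last by apply: aligned_window; lia.
move=> /window_run[b [ab h1 h2 h3]].
have pY := aligned_periodic ab ltac:(lia) p ltac:(lia) ltac:(lia).
have [h4 _] := run_max pY (s := b) ltac:(lia) ltac:(lia) ltac:(lia) ltac:(lia).
have -> : al + X - r = b; last by [].
apply/eqP; rewrite eqn_leq; apply/andP; split; first lia.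
rewrite leqNgt; apply/negP => h; case: brk.
rewrite !ab; [|lia|lia].
by rewrite run; [congr Y|..]; lia.
Qed.

(** A periodic window is determined by its phase. A match lies in the run and starts at a position
    congruent to [al + s], the first of its class in the run; so if the window fits anywhere, it
    fits there. *)
Lemma window_in_run s : s < q -> eqmod q (al + s + (X - e)) A0 ->
  periodic_on Tt q e (e + m) ->
  cyclic_window e <-> al + s + m <= be.
Proof.
move=> sq hs p; split.
  move=> /window_run[b [ab h1 h2 h3]].
  have pY := aligned_periodic ab ltac:(lia) p ltac:(lia) ltac:(lia).
  have [h4 h5] := run_max pY (s := b) ltac:(lia) ltac:(lia) ltac:(lia) ltac:(lia).
  suff : al + s <= b + e - X by lia.
  rewrite leqNgt; apply/negP => h.
  have [|n hn] := @eqmod_le q b (al + s + (X - e)) q_gt0 _ ltac:(lia).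
    by rewrite /eqmod h3 hs.
  by case: n hn => [|n] hn; lia.
move=> h; apply: (@aligned_window (al + s + (X - e))); first lia.
have oc := @occurs_in_run (al + s + (X - e)) ltac:(lia) ltac:(lia) hs.
move=> u hu; apply: (periodic_on_agree (L := L) _ p _ _ run) => //; try lia.
by move=> t tL; rewrite oc.
Qed.

(** The formula is the one computed by the program; the summand [q] keeps the difference of
    remainders from being truncated. *)
Lemma phase_modn d :
  let s := ((A0 - al) %% q + q - d %% q) %% q in
  s < q /\ eqmod q (al + s + d) A0.
Proof.
move=> s; rewrite /s ltn_pmod //; split => //; rewrite /eqmod.
have h : d %% q <= (A0 - al) %% q + q.
  by apply: leq_trans (leq_addl _ _); rewrite ltnW // ltn_pmod.
rewrite -(modnDmr _ d) -addnA addnC -(modnDml _ al) (modnDml _ (d %% q)).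
by rewrite subnK // modnDr modn_mod modnDml subnK.
Qed.

(** The ends of the two runs have to meet, which fixes the alignment. It becomes known only at [h],
    so the earlier letters cannot be compared under it; the congruence and a start not before [al]
    vouch for them by periodicity. *)
Lemma window_right_break h : periodic_on Tt q e h -> Tt (h - q) <> Tt h ->
  X + L <= h < e + m ->
  cyclic_window e <->
  [/\ eqmod q (be + X - h) A0, X + al <= be + X - h + e &
      aligned (be + X - h) h (e + m)].
Proof.
move=> p brk hh; split.
  move=> /window_run[b [ab h1 h2 h3]].
  have pY := aligned_periodic ab ltac:(lia) p ltac:(lia) ltac:(lia).
  have [h4 h5] := run_max pY (s := b) ltac:(lia) ltac:(lia) ltac:(lia) ltac:(lia).
  have <- : b = be + X - h.
    apply/eqP; rewrite eqn_leq; apply/andP; split; first lia.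
    rewrite leqNgt; apply/negP => h6; case: brk.
    rewrite !ab; [|lia|lia].
    by rewrite run; [congr Y|..]; lia.
  split => //; first lia.
  by move=> u hu; apply: ab; lia.
move=> [h1 h2 ab]; apply: (@aligned_window (be + X - h)); first lia.
have oc := @occurs_in_run (be + X - h) ltac:(lia) ltac:(lia) h1.
move=> u hu; case: (leqP h u) => h3; first by apply: ab; lia.
apply: (periodic_on_agree (L := L) _ p _ _ run) => //; try lia.
by move=> t tL; rewrite oc.
Qed.

End Alignments.

(** * A loop-free language and its compilation *)

Inductive arith := Plus | Quo | Rem | Less | Same.

Inductive expr :=
  | Cst of nat | Var of nat | PLen | TLen
  | Bin of arith & expr & expr | Monus of expr & expr
  | PAt of expr | TAt of expr.

Inductive stmt :=
  | Skip | Asg of nat & expr | Seq of stmt & stmt | If of expr & stmt & stmt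
  | Out of expr.

Definition eval_arith o x y :=
  match o with
  | Plus => x + y
  | Quo => x %/ y
  | Rem => x %% y
  | Less => nat_of_bool (x < y)
  | Same => nat_of_bool (x == y)
  end.

Definition upd (E : nat -> nat) v x : nat -> nat :=
  fun u => if Nat.eqb u v then x else E u.

Section Denotation.

Variables P T : seq nat.

Fixpoint den (E : nat -> nat) e : nat :=
  match e with
  | Cst k => k
  | Var v => E v
  | PLen => size P
  | TLen => size T
  | Bin o a b => eval_arith o (den E a) (den E b)
  | Monus a b => den E a - den E b
  | PAt a => nth 0 P (den E a)
  | TAt a => nth 0 T (den E a)
  end.

Fixpoint exec s (E : nat -> nat) : nat -> nat :=
  match s with
  | Skip => E
  | Asg v e => upd E v (den E e)
  | Seq a b => exec b (exec a E)
  | If e a b => if den E e != 0 then exec a E else exec b E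
  | Out _ => E
  end.

Fixpoint outs s (E : nat -> nat) : seq nat :=
  match s with
  | Skip | Asg _ _ => [::]
  | Seq a b => outs a E ++ outs b (exec a E)
  | If e a b => if den E e != 0 then outs a E else outs b E
  | Out e => [:: den E e]
  end.

End Denotation.

(* Every value that occurs while a program runs is at most [growth] times the
   largest initial value. *)
Fixpoint egrowth e : nat :=
  match e with
  | Cst k => k.+1
  | Var _ | PLen | TLen => 1
  | Bin _ a b | Monus a b => egrowth a + egrowth b
  | PAt a | TAt a => egrowth a
  end.

Fixpoint growth s : nat :=
  match s with
  | Skip => 1
  | Asg _ e | Out e => egrowth e
  | Seq a b => growth a * growth b
  | If e a b => egrowth e * (growth a * growth b)
  end.

Lemma egrowth_gt0 e : 0 < egrowth e.
Proof. by elim: e => //= *; lia. Qed.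

Lemma growth_gt0 s : 0 < growth s.
Proof.
elim: s => //= [_ e|a IHa b IHb|e a IHa b IHb|e]; rewrite ?muln_gt0 ?egrowth_gt0 //.
  by rewrite IHa.
by rewrite IHa.
Qed.

(* Registers of bank [k < 2] are the cells congruent to [k] modulo 3; the
   remaining cells hold intermediate results. *)
Definition reg k v := 3 * v + k.
Definition tmp d := 3 * d + 2.
Definition rtmp d := Val (Dir (tmp d)).

Definition arith_op o :=
  match o with
  | Plus => OAdd | Quo => ODiv | Rem => OMod | Less => OLt | Same => OEq
  end.

(** The temporaries from [d] on are the evaluation stack, and the value is left in [tmp d]. *)
Fixpoint cexpr k e d : seq instr :=
  let t := Dir (tmp d) in
  match e with
  | Cst x => [:: Op OAdd t (Imm x) (Imm 0)]
  | Var v => [:: Op OAdd t (Val (Dir (reg k v))) (Imm 0)]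
  | PLen => [:: LenP t]
  | TLen => [:: LenT t]
  | Bin o a b =>
      cexpr k a d ++ cexpr k b d.+1 ++
      [:: Op (arith_op o) t (rtmp d) (rtmp d.+1)]
  | Monus a b =>
      cexpr k a d ++ cexpr k b d.+1 ++
      [:: Op OLt (Dir (tmp d.+2)) (rtmp d) (rtmp d.+1);
          Op OEq (Dir (tmp d.+2)) (rtmp d.+2) (Imm 0);
          Op OSub t (rtmp d) (rtmp d.+1);
          Op OMul t (rtmp d) (rtmp d.+2)]
  | PAt a => cexpr k a d ++ [:: ReadP t (rtmp d)]
  | TAt a => cexpr k a d ++ [:: ReadT t (rtmp d)]
  end.

Fixpoint cstmt k s l : seq instr :=
  match s with
  | Skip => [::]
  | Asg v e =>
      cexpr k e 0 ++ [:: Op OAdd (Dir (reg k v)) (rtmp 0) (Imm 0)]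
  | Seq a b => let ca := cstmt k a l in ca ++ cstmt k b (l + size ca)
  | If e a b =>
      let ce := cexpr k e 0 in
      let la := l + size ce + 1 in
      let ca := cstmt k a la in
      let lb := la + size ca + 1 in
      let cb := cstmt k b lb in
      ce ++ [:: Jz (rtmp 0) lb] ++ ca ++ [:: Jz (Imm 0) (lb + size cb)] ++ cb
  | Out e => cexpr k e 0 ++ [:: Report (rtmp 0)]
  end.

(** * Simulation of statements by the compiled code, without overflow *)

Section Correctness.

Variables (w : nat) (A : program) (P T : seq nat).

(** The space component is left open, since [run_space] bounds it separately from the addresses in
    the code. *)
Definition reaches n l M o l' M' o' := forall sp, exists sp',
  iter n (step w A P T) (Conf l M sp false o) = Conf l' M' sp' false o'.

Lemma reaches_trans n1 n2 l1 M1 o1 l2 M2 o2 l3 M3 o3 :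
  reaches n1 l1 M1 o1 l2 M2 o2 -> reaches n2 l2 M2 o2 l3 M3 o3 ->
  reaches (n1 + n2) l1 M1 o1 l3 M3 o3.
Proof.
move=> h1 h2 sp; have [sp1 e1] := h1 sp; have [sp2 e2] := h2 sp1.
by exists sp2; rewrite addnC iterD e1 e2.
Qed.

Lemma reaches_op l M o op d x y : nth Await A l = Op op d x y ->
  reaches 1 l M o l.+1
    (write w M d (eval_binop w op (eval w M x) (eval w M y))) o.
Proof. by move=> hi sp; rewrite /= /step /= hi; eexists. Qed.

Lemma reaches_readP l M o d x : nth Await A l = ReadP d x ->
  reaches 1 l M o l.+1 (write w M d (nth 0 P (eval w M x))) o.
Proof. by move=> hi sp; rewrite /= /step /= hi; eexists. Qed.

Lemma reaches_readT l M o d x : nth Await A l = ReadT d x ->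
  reaches 1 l M o l.+1 (write w M d (nth 0 T (eval w M x))) o.
Proof. by move=> hi sp; rewrite /= /step /= hi; eexists. Qed.

Lemma reaches_lenP l M o d : nth Await A l = LenP d ->
  reaches 1 l M o l.+1 (write w M d (size P)) o.
Proof. by move=> hi sp; rewrite /= /step /= hi; eexists. Qed.

Lemma reaches_lenT l M o d : nth Await A l = LenT d ->
  reaches 1 l M o l.+1 (write w M d (size T)) o.
Proof. by move=> hi sp; rewrite /= /step /= hi; eexists. Qed.

Lemma reaches_jz l M o x l' : nth Await A l = Jz x l' ->
  reaches 1 l M o (if eval w M x == 0 then l' else l.+1) M o.
Proof. by move=> hi sp; rewrite /= /step /= hi; eexists. Qed.

Lemma reaches_report l M o x : nth Await A l = Report x ->
  reaches 1 l M o l.+1 M (rcons o (eval w M x)).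
Proof. by move=> hi sp; rewrite /= /step /= hi; eexists. Qed.

Definition code_at l (c : seq instr) :=
  forall j, j < size c -> nth Await A (l + j) = nth Await c j.

Lemma code_at_cat l c1 c2 :
  code_at l (c1 ++ c2) <-> code_at l c1 /\ code_at (l + size c1) c2.
Proof.
split=> [h|[h1 h2] j].
  split=> j hj; first by rewrite h ?size_cat ?nth_cat ?hj //; lia.
  by rewrite -addnA h ?size_cat ?ltn_add2l // nth_cat ltnNge leq_addr /= addKn.
rewrite size_cat nth_cat; case: (ltnP j (size c1)) => hj hj'; first exact: h1.
by have := h2 (j - size c1); rewrite -addnA subnKC // => -> //; lia.
Qed.

Lemma code_at1 l i : code_at l [:: i] -> nth Await A l = i.
Proof. by move=> /(_ 0 isT); rewrite addn0. Qed.

Lemma code_at_cons l i c :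
  code_at l (i :: c) -> nth Await A l = i /\ code_at l.+1 c.
Proof.
by rewrite -cat1s => /code_at_cat[/code_at1 h]; rewrite addn1.
Qed.

Lemma writeE M a v b : v < 2 ^ w ->
  write w M (Dir a) v b = if b == a then v else M b.
Proof. by move=> h; rewrite /write /= /trunc modn_small. Qed.

Lemma trunc0 : trunc w 0 = 0.
Proof. by rewrite /trunc mod0n. Qed.

Lemma truncE v : v < 2 ^ w -> trunc w v = v.
Proof. by move=> h; rewrite /trunc modn_small. Qed.

Variables (k V : nat).
Hypotheses (k2 : k < 2) (V_gt0 : 0 < V) (PV : size P <= V) (TV : size T <= V).
Hypotheses (lP : all (fun x => x <= V) P) (lT : all (fun x => x <= V) T).

Lemma nth_le (s : seq nat) j : all (fun x => x <= V) s -> nth 0 s j <= V.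
Proof.
move=> h; case: (ltnP j (size s)) => hj; first exact: (allP h _ (mem_nth _ hj)).
by rewrite nth_default.
Qed.

Lemma den_le E U e : (forall v, E v <= U) -> V <= U -> den P T E e <= egrowth e * U.
Proof.
move=> hE VU; elim: e => [x|v| | |o a IHa b IHb|a IHa b IHb|a IHa|a IHa] /=.
- by rewrite mulSn; nia.
- by rewrite mul1n.
- by rewrite mul1n; lia.
- by rewrite mul1n; lia.
- have h1 := egrowth_gt0 a; have h2 := egrowth_gt0 b.
  rewrite mulnDl; case: o => /=.
  + exact: leq_add.
  + by apply: leq_trans (leq_div _ _) _; lia.
  + by apply: leq_trans (leq_mod _ _) _; lia.
  + by apply: leq_trans (leq_b1 _) _; nia.
  + by apply: leq_trans (leq_b1 _) _; nia.
- by rewrite mulnDl; lia.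
- by have := nth_le (den P T E a) lP; have := egrowth_gt0 a; nia.
- by have := nth_le (den P T E a) lT; have := egrowth_gt0 a; nia.
Qed.

Lemma exec_le E U s : (forall v, E v <= U) -> V <= U ->
  forall v, exec P T s E v <= growth s * U.
Proof.
elim: s E U => [|v e|a IHa b IHb|e a IHa b IHb|e] E U hE VU u /=.
- by rewrite mul1n.
- rewrite /upd; case: Nat.eqb; first exact: den_le.
  by have := hE u; have := egrowth_gt0 e; nia.
- have h := growth_gt0 a.
  rewrite mulnAC mulnC; apply: IHb; last nia.
  by move=> v; apply: IHa.
- have h1 := growth_gt0 a; have h2 := growth_gt0 b; have h3 := egrowth_gt0 e.
  case: ifP => _.
    have := IHa E U hE VU u; set x := exec _ _ _ _ _.
    move=> h; apply: (leq_trans h); rewrite leq_mul2r; apply/orP; right.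
    by rewrite mulnCA leq_pmulr // muln_gt0 h3.
  have := IHb E U hE VU u; set x := exec _ _ _ _ _.
  move=> h; apply: (leq_trans h); rewrite leq_mul2r; apply/orP; right.
  by rewrite mulnA leq_pmull // muln_gt0 h3.
- by have := hE u; have := egrowth_gt0 e; nia.
Qed.

Lemma write_tmp M d v : v < 2 ^ w -> write w M (Dir (tmp d)) v (tmp d) = v.
Proof. by move=> hv; rewrite writeE // eqxx. Qed.

Lemma write_tmp_neq M d v b : v < 2 ^ w -> b <> tmp d ->
  write w M (Dir (tmp d)) v b = M b.
Proof. by move=> hv h; rewrite writeE //; case: eqP. Qed.

Lemma reg_neq_tmp v d : reg k v <> tmp d.
Proof. by rewrite /reg /tmp; lia. Qed.

Definition expr_ok E U e := forall d l M o,
  code_at l (cexpr k e d) -> (forall v, M (reg k v) = E v) ->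
  (forall v, E v <= U) -> egrowth e * U < 2 ^ w ->
  exists n M', [/\ n <= size (cexpr k e d),
    reaches n l M o (l + size (cexpr k e d)) M' o,
    M' (tmp d) = den P T E e &
    forall b, (forall d', d <= d' -> b <> tmp d') -> M' b = M b].

Lemma expr_ok2 E U a b d l M o : expr_ok E U a -> expr_ok E U b ->
  let c := cexpr k a d ++ cexpr k b d.+1 in
  code_at l c -> (forall v, M (reg k v) = E v) ->
  (forall v, E v <= U) -> (egrowth a + egrowth b) * U < 2 ^ w ->
  exists n M', [/\ n <= size c, reaches n l M o (l + size c) M' o,
    M' (tmp d) = den P T E a /\ M' (tmp d.+1) = den P T E b &
    forall b, (forall d', d <= d' -> b <> tmp d') -> M' b = M b].
Proof.
move=> IHa IHb c /code_at_cat[ca cb] hM hE; rewrite mulnDl => hw.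
have [n1 [M1 [s1 r1 v1 f1]]] := IHa d l M o ca hM hE ltac:(lia).
have [n2 [M2 [s2 r2 v2 f2]]] : exists n M', [/\ n <= size (cexpr k b d.+1),
    reaches n (l + size (cexpr k a d)) M1 o
      (l + size (cexpr k a d) + size (cexpr k b d.+1)) M' o,
    M' (tmp d.+1) = den P T E b &
    forall b0, (forall d', d.+1 <= d' -> b0 <> tmp d') -> M' b0 = M1 b0].
  apply: IHb => //; last lia.
  by move=> v; rewrite f1 ?hM // => d' _; apply: reg_neq_tmp.
exists (n1 + n2), M2; rewrite size_cat addnA; split.
- lia.
- exact: reaches_trans r1 r2.
- by split=> //; rewrite f2 ?v1 // => d' h; rewrite /tmp; lia.
- by move=> x hx; rewrite f2 ?f1 // => d' h; apply: hx; lia.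
Qed.

(** The machine subtraction wraps around; the factor, which is the negated test [x < y], cuts it off
    at 0. *)
Lemma eval_binop_sub x y : x < 2 ^ w -> y < 2 ^ w -> 1 < 2 ^ w ->
  eval_binop w OMul (eval_binop w OSub x y)
    (eval_binop w OEq (eval_binop w OLt x y) 0) = x - y.
Proof.
move=> hx hy h1; rewrite /eval_binop /trunc.
case: (ltnP x y) => h /=.
  by rewrite (modn_small h1) /= mod0n muln0 mod0n; lia.
rewrite mod0n /= (modn_small h1) muln1 modn_mod.
have -> : x + (2 ^ w - y) = x - y + 2 ^ w by lia.
by rewrite modnDr modn_small //; lia.
Qed.

Lemma eval_binop_lt o x y : eval_binop w o x y < 2 ^ w.
Proof. by rewrite /eval_binop /trunc ltn_pmod // expn_gt0. Qed.

Lemma cexpr_correct E U e : V <= U -> expr_ok E U e.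
Proof.
move=> VU; elim: e => [x|v| | |op a IHa b IHb|a IHa b IHb|a IHa|a IHa] d l M o /=.
- move=> /code_at1 cA hM hE hw; have hx : x < 2 ^ w by nia.
  exists 1; eexists; split; [by []|by rewrite addn1; apply: reaches_op cA| |].
    by rewrite /= /eval_binop !truncE ?addn0 ?write_tmp //; lia.
  move=> b hb; rewrite write_tmp_neq ?eval_binop_lt //; exact: hb.
- move=> /code_at1 cA hM hE hw; have hx : E v < 2 ^ w by have := hE v; lia.
  exists 1; eexists; split; [by []|by rewrite addn1; apply: reaches_op cA| |].
    by rewrite /= /eval_binop hM !truncE ?addn0 ?write_tmp //; lia.
  move=> b hb; rewrite write_tmp_neq ?eval_binop_lt //; exact: hb.
- move=> /code_at1 cA hM hE hw; have hx : size P < 2 ^ w by lia.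
  exists 1; eexists; split; [by []|by rewrite addn1; apply: reaches_lenP cA| |].
    by rewrite write_tmp.
  by move=> b hb; rewrite write_tmp_neq //; apply: hb.
- move=> /code_at1 cA hM hE hw; have hx : size T < 2 ^ w by lia.
  exists 1; eexists; split; [by []|by rewrite addn1; apply: reaches_lenT cA| |].
    by rewrite write_tmp.
  by move=> b hb; rewrite write_tmp_neq //; apply: hb.
- rewrite catA => /code_at_cat[cA cop] hM hE hw.
  have [n [M1 [s1 r1 [va vb] f1]]] := expr_ok2 o IHa IHb cA hM hE hw.
  have hd := den_le (Bin op a b) hE VU.
  exists (n + 1); eexists; split.
  + by rewrite size_cat /=; lia.
  + rewrite size_cat /= addn1 addnA addn1.
    by rewrite -[n.+1]addn1; apply: reaches_trans r1 (reaches_op _ _ (code_at1 cop)).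
  + rewrite write_tmp ?eval_binop_lt //= va vb /eval_binop.
    have {}hd : eval_arith op (den P T E a) (den P T E b) < 2 ^ w by move: hd => /=; lia.
    by case: op cop hd => /= _ hd; rewrite truncE.
  + move=> x hx; rewrite write_tmp_neq ?eval_binop_lt ?f1 //; exact: hx.
- rewrite catA => /code_at_cat[cA cop] hM hE hw.
  have [n [M1 [s1 r1 [va vb] f1]]] := expr_ok2 o IHa IHb cA hM hE hw.
  have ha := den_le a hE VU; have hb := den_le b hE VU; rewrite mulnDl in hw.
  have g1 := egrowth_gt0 a; have g2 := egrowth_gt0 b.
  have h1 : 1 < 2 ^ w by nia.
  set c := cexpr k a d ++ _ in cA r1 s1 cop *.
  have c0 := cop 0 isT; have c1 := cop 1 isT; have c2 := cop 2 isT; have c3 := cop 3 isT.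
  rewrite /= addn0 in c0; rewrite /= addn1 in c1; rewrite /= addn2 in c2.
  rewrite /= addn3 in c3.
  have r2 := reaches_trans r1 (reaches_op _ _ c0).
  have r3 := reaches_trans r2 (reaches_op _ _ c1).
  have r4 := reaches_trans r3 (reaches_op _ _ c2).
  have r5 := reaches_trans r4 (reaches_op _ _ c3).
  have E4 : (l + size c).+4 = l + (size c + 4) by lia.
  rewrite E4 in r5; rewrite size_cat.
  refine (ex_intro _ _ (ex_intro _ _ (And4 _ r5 _ _))); first by rewrite /=; lia.
  + rewrite write_tmp ?eval_binop_lt //=.
    have nt d1 d2 : d1 <> d2 -> tmp d1 <> tmp d2 by rewrite /tmp; lia.
    do ?[rewrite write_tmp ?eval_binop_lt // |
         rewrite write_tmp_neq ?eval_binop_lt //; last by apply: nt; lia].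
    by rewrite va vb trunc0 eval_binop_sub //; lia.
  + by move=> x hx; rewrite !write_tmp_neq ?eval_binop_lt ?f1 //; apply: hx; lia.
- move=> /code_at_cat[cA /code_at1 cop] hM hE hw.
  have [n [M1 [s1 r1 va f1]]] := IHa d l M o cA hM hE hw.
  have hx : nth 0 P (den P T E a) < 2 ^ w.
    by have := nth_le (den P T E a) lP; have := egrowth_gt0 a; nia.
  exists (n + 1); eexists; split.
  + by rewrite size_cat /=; lia.
  + by rewrite size_cat /= addnA [_ + _ + 1]addn1; apply: reaches_trans r1 (reaches_readP _ _ cop).
  + by rewrite /= va write_tmp.
  + by move=> x hx'; rewrite /= va write_tmp_neq ?f1 //; apply: hx'.
- move=> /code_at_cat[cA /code_at1 cop] hM hE hw.
  have [n [M1 [s1 r1 va f1]]] := IHa d l M o cA hM hE hw.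
  have hx : nth 0 T (den P T E a) < 2 ^ w.
    by have := nth_le (den P T E a) lT; have := egrowth_gt0 a; nia.
  exists (n + 1); eexists; split.
  + by rewrite size_cat /=; lia.
  + by rewrite size_cat /= addnA [_ + _ + 1]addn1; apply: reaches_trans r1 (reaches_readT _ _ cop).
  + by rewrite /= va write_tmp.
  + by move=> x hx'; rewrite /= va write_tmp_neq ?f1 //; apply: hx'.
Qed.

Lemma cstmt_correct s : forall E U l M o,
  code_at l (cstmt k s l) -> (forall v, M (reg k v) = E v) ->
  (forall v, E v <= U) -> V <= U -> growth s * U < 2 ^ w ->
  exists n M', [/\ n <= size (cstmt k s l),
    reaches n l M o (l + size (cstmt k s l)) M' (o ++ outs P T s E),
    forall v, M' (reg k v) = exec P T s E v &
    forall b, (forall v, b <> reg k v) -> (forall d, b <> tmp d) -> M' b = M b].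
Proof.
elim: s => [|v e|a IHa b IHb|e a IHa b IHb|e] E U l M o cA hM hE VU hw.
- exists 0, M; rewrite /= addn0 cats0; split => // sp.
  by exists sp.
- move: cA => /= /code_at_cat[cA /code_at1 cop].
  have [n [M1 [s1 r1 va f1]]] := cexpr_correct VU o cA hM hE hw.
  have hd := den_le e hE VU; rewrite /= in hw.
  exists (n + 1); eexists; split.
  + by rewrite size_cat /=; lia.
  + rewrite size_cat /= addnA [_ + _ + 1]addn1 cats0.
    exact: reaches_trans r1 (reaches_op _ _ cop).
  + move=> u; rewrite writeE ?eval_binop_lt //= /upd.
    case: PeanoNat.Nat.eqb_spec => [->|ne]; last first.
      case: eqP => [h|_]; first by case: ne; move: h; rewrite /reg; lia.
      by rewrite f1 ?hM // => d' _; apply: reg_neq_tmp.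
    by rewrite eqxx va /eval_binop truncE trunc0 addn0 //; lia.
  + move=> x hx hx'; rewrite writeE ?eval_binop_lt //.
    case: eqP => [h|_]; first by case: (hx v).
    by apply: f1 => d' _; apply: hx'.
- move: cA => /= /code_at_cat[ca cb].
  have g1 := growth_gt0 a; have g2 := growth_gt0 b.
  have hw' : growth b * (growth a * U) < 2 ^ w.
    by move: hw => /=; rewrite mulnA [growth b * _]mulnC.
  have [|n1 [M1 [s1 r1 v1 f1]]] := IHa E U l M o ca hM hE VU; first nia.
  have [||n2 [M2 [s2 r2 v2 f2]]] :=
    IHb _ (growth a * U) _ M1 (o ++ outs P T a E) cb v1 _ _ hw'.
  + exact: exec_le.
  + nia.
  exists (n1 + n2), M2; rewrite size_cat addnA catA; split => //.
  + lia.
  + exact: reaches_trans r1 r2.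
  + by move=> x hx hx'; rewrite f2 ?f1.
- move: cA => /=; set ce := cexpr k e 0.
  set ca := cstmt k a _; set cb := cstmt k b _.
  move=> /code_at_cat[cE /code_at_cons[cj]].
  move=> /code_at_cat[cA /code_at_cons[cj' cB]].
  have cA' : code_at (l + size ce + 1) ca by rewrite addn1.
  have cB' : code_at (l + size ce + 1 + size ca + 1) cb by rewrite !addn1 addSn.
  have g1 := growth_gt0 a; have g2 := growth_gt0 b; have g3 := egrowth_gt0 e.
  have le1 : egrowth e * U <= growth (If e a b) * U.
    by rewrite /= leq_mul2r leq_pmulr ?orbT // muln_gt0 g1.
  have le2 : growth a * U <= growth (If e a b) * U.
    by rewrite /= leq_mul2r mulnCA leq_pmulr ?orbT // muln_gt0 g3.
  have le3 : growth b * U <= growth (If e a b) * U.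
    by rewrite /= leq_mul2r mulnA leq_pmull ?orbT // muln_gt0 g3.
  have [|n1 [M1 [s1 r1 v1 f1]]] := cexpr_correct VU o cE hM hE; first lia.
  have hM1 v : M1 (reg k v) = E v.
    by rewrite f1 ?hM // => d' _; apply: reg_neq_tmp.
  have r2 := reaches_trans r1 (reaches_jz M1 o cj).
  rewrite /= v1 in r2.
  rewrite !size_cat /= size_cat /=.
  case: (eqVneq (den P T E e) 0) r2 => he r2 /=.
    have [|n2 [M2 [s2 r3 v2 f2]]] := IHb E U _ M1 o cB' hM1 hE VU; first lia.
    exists (n1 + 1 + n2), M2; split => //.
    - by rewrite -/ce in s1; rewrite -/cb in s2; lia.
    - have -> : l + (size ce + (size ca + (size cb).+1).+1) =
                l + size ce + 1 + size ca + 1 + size cb by lia.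
      exact: reaches_trans r2 r3.
    - by move=> x hx hx'; rewrite f2 // f1.
  have [|n2 [M2 [s2 r3 v2 f2]]] := IHa E U _ M1 o cA' hM1 hE VU; first lia.
  rewrite -/ca in s2 r3; rewrite -/ce in s1.
  have r4 := reaches_jz M2 (o ++ outs P T a E) cj'.
  rewrite /= trunc0 eqxx in r4.
  exists (n1 + 1 + (n2 + 1)), M2; split => //.
  + lia.
  + have -> : l + (size ce + (size ca + (size cb).+1).+1) =
              l + size ce + 1 + size ca + 1 + size cb by lia.
    rewrite addn1 in r3; apply: reaches_trans r2 (reaches_trans r3 r4).
  + by move=> x hx hx'; rewrite f2 // f1.
- move: cA => /= /code_at_cat[cA /code_at1 cop].
  have [n [M1 [s1 r1 va f1]]] := cexpr_correct VU o cA hM hE hw.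
  exists (n + 1); eexists; split.
  + by rewrite size_cat /=; lia.
  + rewrite size_cat /= addnA [_ + _ + 1]addn1 cats1 -va.
    exact: reaches_trans r1 (reaches_report _ _ cop).
  + by move=> u; rewrite f1 ?hM // => d' _; apply: reg_neq_tmp.
  + by move=> x hx hx'; apply: f1 => d' _; apply: hx'.
Qed.

End Correctness.

(** * Online programs *)

Definition direct_loc l := if l is Dir _ then true else false.

Definition direct_operand x := if x is Val l then direct_loc l else true.

Definition direct_instr i :=
  match i with
  | Op _ d x y => [&& direct_loc d, direct_operand x & direct_operand y]
  | ReadP d x | ReadT d x => direct_loc d && direct_operand x
  | LenP d | LenT d => direct_loc d
  | Jz x _ | Report x => direct_operand x
  | Await => true
  end.

Definition static_space (A : program) := 
  \max_(j < size A) instr_space (fun=> 0) (nth Await A j).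

Lemma instr_space_direct M i : direct_instr i ->
  instr_space M i = instr_space (fun=> 0) i.
Proof. by case: i => [? [?|?] [?|[?|?]] [?|[?|?]]|[?|?] [?|[?|?]]|[?|?] [?|[?|?]]|[?|?]|[?|?]|[?|[?|?]]|[?|[?|?]]|]. Qed.

Lemma step_space w A P T s : all direct_instr A -> space s <= static_space A ->
  space (step w A P T s) <= static_space A.
Proof.
move=> dA hs; rewrite /step; case: ifP => // _.
set i := nth Await A (pc s).
have hi : instr_space (Defs.mem s) i <= static_space A.
  case: (ltnP (pc s) (size A)) => h; last by rewrite /i nth_default.
  rewrite instr_space_direct; last exact: (all_nthP _ dA).
  exact: (leq_bigmax (Ordinal h)).
by case: i hi => [? ? ? ?|? ?|? ?|?|?|? ?|?|] /= hi; rewrite geq_max hs.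
Qed.

Lemma run_space w A P T t i : all direct_instr A ->
  space (run w A P T t i) <= static_space A.
Proof.
move=> dA; elim: i => //= i IHi.
have : space (deliver (run w A P T t i)) <= static_space A by [].
by move: (deliver _) {IHi} => s hs; elim: t => //= n IHn; apply: step_space.
Qed.

Lemma cexpr_direct k e d : all direct_instr (cexpr k e d).
Proof.
elim: e d => //= [o a IHa b IHb|a IHa b IHb|a IHa|a IHa] d;
  by rewrite !all_cat IHa ?IHb.
Qed.

Lemma cstmt_direct k s l : all direct_instr (cstmt k s l).
Proof.
elim: s l => //= [v e|a IHa b IHb|e a IHa b IHb|e] l.
- by rewrite all_cat cexpr_direct.
- by rewrite all_cat IHa IHb.
- by rewrite all_cat cexpr_direct /= all_cat IHa /= IHb.
- by rewrite all_cat cexpr_direct.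
Qed.

(* The first two instructions treat the empty pattern, for which the words
   may have no bits. *)
Definition online_prog (S0 S1 : stmt) : program :=
  let c0 := cstmt 0 S0 2 in
  let c1 := cstmt 1 S1 (2 + size c0) in
  [:: LenP (Dir 2), Jz (Val (Dir 2)) (2 + size c0 + size c1) &
      c0 ++ c1 ++ [:: Await; Jz (Imm 0) 0]].

Lemma online_prog_direct S0 S1 : all direct_instr (online_prog S0 S1).
Proof. by rewrite /= !all_cat !cstmt_direct. Qed.

Fixpoint env (P T : seq nat) (s : stmt) i : nat -> nat :=
  if i is j.+1 then exec P (take i T) s (env P T s j) else fun=> 0.

Lemma step_await w A P T l M sp o : nth Await A l = Await ->
  step w A P T (Conf l M sp false o) = Conf l.+1 M sp true o.
Proof. by move=> h; rewrite /step /= h /= maxn0. Qed.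

Lemma runS w A P T t i : run w A P T t i.+1 =
  iter t (step w A P (take i.+1 T)) (deliver (run w A P T t i)).
Proof. by []. Qed.

Section Run.

Variables (w : nat) (S0 S1 : stmt) (P T : seq nat).
Let A := online_prog S0 S1.
Let c0 := cstmt 0 S0 2.
Let c1 := cstmt 1 S1 (2 + size c0).
Let la := 2 + size c0 + size c1.
Let t := size A.

Lemma iter_waiting n T' s : waiting s -> iter n (step w A P T') s = s.
Proof. by move=> h; elim: n => //= n ->; rewrite /step h. Qed.

Lemma size_online_prog : t = la + 2.
Proof. by rewrite /t /= !size_cat /= -/c0 -/c1 /la; lia. Qed.

Lemma code_at_online_prog : [/\ code_at A 2 c0, code_at A (2 + size c0) c1,
  nth Await A la = Await & nth Await A la.+1 = Jz (Imm 0) 0].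
Proof.
have h : code_at A 2 (c0 ++ c1 ++ [:: Await; Jz (Imm 0) 0]) by [].
move: h => /code_at_cat[h1 /code_at_cat[h2 h3]]; split => //.
  by have := h3 0 isT; rewrite addn0.
by have := h3 1 isT; rewrite addn1.
Qed.

Lemma reaches_await T' n l M o M' o' : n < t ->
  reaches w A P T' n l M o la M' o' ->
  forall sp, exists sp',
    iter t (step w A P T') (Conf l M sp false o) = Conf la.+1 M' sp' true o'.
Proof.
move=> nt h sp; have [sp1 e1] := h sp.
have -> : t = (t - n.+1) + (1 + n) by lia.
have [_ _ h1 _] := code_at_online_prog.
rewrite iterD [iter (1 + n) _ _]iterD e1 [iter 1 _ _]/= step_await //.
by exists sp1; apply: iter_waiting.
Qed.

Definition at_start l := l = 0 \/ l = la.+1.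

Lemma reaches_start T' l M o : at_start l ->
  exists2 n, n <= 1 & reaches w A P T' n l M o 0 M o.
Proof.
case=> ->; first by exists 0 => // sp; exists sp.
exists 1 => //; have [_ _ _ h] := code_at_online_prog.
by have := reaches_jz w P T' M o h; rewrite /= trunc0.
Qed.

Lemma run_nil i : P = [::] -> let s := run w A P T t i in
  [/\ waiting s, at_start (pc s) & reports s = [::]].
Proof.
move=> P0 s; rewrite /s {s}; elim: i => [|i [_ hpc _]]; first by split => //; left.
rewrite runS /deliver.
set M := Defs.mem _; set sp := space _; set l := pc _ in hpc *.
have [n n1 r0] := reaches_start (take i.+1 T) M [::] hpc.
have r1 := @reaches_lenP w A P (take i.+1 T) 0 M [::] (Dir 2) erefl.
set M1 := write _ _ _ _ in r1.
have r2 := @reaches_jz w A P (take i.+1 T) 1 M1 [::] (Val (Dir 2)) la erefl.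
have e : eval w M1 (Val (Dir 2)) = 0 by rewrite /= /M1 P0 /write /= trunc0.
rewrite e eqxx in r2.
have r := reaches_trans r0 (reaches_trans r1 r2).
have [|sp' ->] := reaches_await _ r sp; last by split => //; right.
by rewrite size_online_prog /la; lia.
Qed.

Variable V : nat.
Hypotheses (P_gt0 : 0 < size P) (PV : size P <= V) (TV : size T <= V).
Hypotheses (lP : all (fun x => x <= V) P) (lT : all (fun x => x <= V) T).
(** The same bound is restored after every letter, so the factor [growth] does not compound along
    the text. *)
Hypothesis env0 : forall i v, i <= size T -> env P T S0 i v <= V.
Hypothesis env1 : forall i v, i <= size T -> env P T S1 i v <= V.
Hypotheses (g0 : growth S0 * V < 2 ^ w) (g1 : growth S1 * V < 2 ^ w).

Lemma run_correct i : i <= size T -> let s := run w A P T t i in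
  [/\ waiting s, at_start (pc s),
      forall v, Defs.mem s (reg 0 v) = env P T S0 i v,
      forall v, Defs.mem s (reg 1 v) = env P T S1 i v &
      i != 0 -> reports s = outs P (take i T) S0 (env P T S0 i.-1) ++
                            outs P (take i T) S1 (env P T S1 i.-1)].
Proof.
move=> hi s; rewrite /s {s}; elim: i hi => [|i IHi] hi; first by split => //; left.
have [_ hpc h0 h1 _] := IHi (ltnW hi).
rewrite runS /deliver.
set M := Defs.mem _ in h0 h1 *; set sp := space _; set l := pc _ in hpc *.
set T' := take i.+1 T.
have T'V : size T' <= V by rewrite size_take; case: ifP => // _; lia.
have lT' : all (fun x => x <= V) T'.
  by apply/allP => x /mem_take; apply: (allP lT).
have V_gt0 : 0 < V by lia.
have [n n1 r0] := reaches_start T' M [::] hpc.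
have r1 := @reaches_lenP w A P T' 0 M [::] (Dir 2) erefl.
set M1 := write _ _ _ _ in r1.
have hV : V < 2 ^ w by have := growth_gt0 S0; nia.
have hP : size P < 2 ^ w by lia.
have r2 := @reaches_jz w A P T' 1 M1 [::] (Val (Dir 2)) la erefl.
have e : eval w M1 (Val (Dir 2)) = size P by rewrite /= /M1 writeE.
rewrite e (_ : (size P == 0) = false) in r2; last lia.
(* Cell 2 is [tmp 0], so the length test leaves both register banks intact. *)
have hM1 b : b <> 2 -> M1 b = M b by move=> hb; rewrite /M1 writeE //; case: eqP.
have [ca0 ca1 _ _] := code_at_online_prog.
have [||n3 [M3 [s3 r3 v3 f3]]] :=
  @cstmt_correct w A P T' 0 V isT V_gt0 PV T'V lP lT' S0 (env P T S0 i) V 2 M1 [::]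
    ca0 _ _ (leqnn V) g0.
- by move=> v; rewrite hM1 // /reg; lia.
- by move=> v; apply: env0; lia.
have [||n4 [M4 [s4 r4 v4 f4]]] :=
  @cstmt_correct w A P T' 1 V isT V_gt0 PV T'V lP lT' S1 (env P T S1 i) V _ M3 
    ([::] ++ outs P T' S0 (env P T S0 i)) ca1 _ _ (leqnn V) g1.
- move=> v; rewrite f3 ?hM1 ?h1 //.
  + by rewrite /reg; lia.
  + by move=> v'; rewrite /reg; lia.
  + by move=> d; rewrite /reg /tmp; lia.
- by move=> v; apply: env1; lia.
have r := reaches_trans r0 (reaches_trans r1 (reaches_trans r2 (reaches_trans r3 r4))).
have [|sp' ->] := reaches_await _ r sp.
  by rewrite size_online_prog /la; rewrite -/c0 in s3; rewrite -/c1 in s4; lia.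
split => //=; first by right.
move=> v; rewrite f4 ?v3 //.
- by move=> v'; rewrite /reg; lia.
- by move=> d; rewrite /reg /tmp; lia.
Qed.

End Run.

(** * Loop invariants of a job *)

Section MaxSuffixLoop.

Variables (c : nat -> nat) (L : nat).

(** This is the two-pointer scheme known from minimal rotations: candidate [a] and challenger [b]
    agree on [k] letters, and a mismatch rejects [k + 1] starts of the losing side at once. *)
Definition maxsuf_inv o a b k :=
  [/\ a < b, b + k <= L,
      forall s, s < b -> s != a -> dominated c L o s &
      forall k', k' < k -> c (a + k') = c (b + k')].

Lemma maxsuf_init o : 0 < L -> maxsuf_inv o 0 1 0.
Proof. by move=> h; split => // s h1 h2; lia. Qed.

Lemma maxsuf_eq o a b k : maxsuf_inv o a b k -> b + k < L ->
  c (a + k) = c (b + k) -> maxsuf_inv o a b k.+1.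
Proof.
move=> [h1 h2 h3 h4] h5 h6; split => //; first lia.
by move=> k'; rewrite ltnS leq_eqVlt => /orP[/eqP->|/h4].
Qed.

Lemma maxsuf_keep o a b k : maxsuf_inv o a b k -> b + k < L ->
  letter_lt o (c (b + k)) (c (a + k)) -> maxsuf_inv o a (b + k.+1) 0.
Proof.
move=> [h1 h2 h3 h4] h5 h6; split => //; [lia|lia|].
move=> s hs sa; case: (ltnP s b) => hb; first exact: h3.
exists (a + (s - b)); first lia.
rewrite -{1}(subnKC hb); apply: (@suffix_lt_shift _ _ _ _ _ k); [lia| |lia|].
  by move=> k' h; rewrite h4.
by right.
Qed.

(** A start [s] in [[a, a + k]] loses to [b + (s - a)], and the other starts below [b] were rejected
    before; the maximum is the first start still alive. *)
Lemma maxsuf_switch o a b k : maxsuf_inv o a b k -> b + k < L ->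
  letter_lt o (c (a + k)) (c (b + k)) ->
  maxsuf_inv o (maxn (a + k.+1) b) (maxn (a + k.+1) b + 1) 0.
Proof.
move=> [h1 h2 h3 h4] h5 h6; split => //; [lia|lia|].
move=> s hs sa.
case: (ltnP s a) => ha; first by apply: h3; lia.
case: (leqP s (a + k)) => hk; last by apply: h3; lia.
exists (b + (s - a)); first lia.
rewrite -{1}(subnKC ha); apply: (@suffix_lt_shift _ _ _ _ _ k) => //; [lia|right].
by split => //; lia.
Qed.

Lemma maxsuf_end o a b k : maxsuf_inv o a b k -> L <= b + k -> max_suffix c L o a.
Proof.
move=> [h1 h2 h3 h4] h5; apply: max_suffix_undominated; first lia.
move=> s sL sa; case: (ltnP s b) => hb; first exact: h3.
exists (a + (s - b)); first lia.
rewrite -{1}(subnKC hb); apply: (@suffix_lt_shift _ _ _ _ _ k); [lia| |lia|left; lia].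
by move=> k' h; rewrite h4.
Qed.

End MaxSuffixLoop.

(** * Search for the alignments, delimitation of the runs, and the answer for a window *)

Section SearchLoop.

Variables (m B L : nat) (Y Tt : nat -> nat) (X : nat).
Hypothesis (m8 : 8 * B <= m) (B_gt0 : 0 < B) (defL : L = m - 2 * B).
Hypothesis Yper : forall t, Y (t + m) = Y t.

Let c t := Tt (X + t).
Notation occ := (occurs c L Y).
Let occDm := occursDm L Tt X Yper.

Definition no_occ lo hi := forall s, lo <= s < hi -> ~ occ s.

(** [g] counts the recorded alignments and [pv] is the last one. A second is recorded only at a
    distance above [m / 2] from the first; a smaller gap ends the search. *)
Definition searched g pv p :=
  match g with
  | 0 => no_occ 0 p
  | 1 => [/\ pv < m, occ pv, pv < p & no_occ pv.+1 p]
  | 2 => exists pv0, [/\ pv0 < m, occ pv0, m < 2 * (pv - pv0),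
           no_occ pv0.+1 pv & [/\ pv0 < pv, occ pv, pv < p & no_occ pv.+1 p]]
  | _ => False
  end.

(** [a + m] is again an occurrence; as [pv < 2 * m], this keeps the search within [3 * m]. *)
Lemma no_occ_le a p : occ a -> no_occ a.+1 p -> p <= a + m.
Proof.
move=> oa h; rewrite leqNgt; apply/negP => hp.
by apply: (h (a + m)); [lia | apply/occDm].
Qed.

Definition search_inv x p j :=
  [/\ x < L, crit_cut c L x,
      forall k, k < j -> x + k < L -> Y (p + x + k) = c (x + k),
      forall k, k < j -> k < x -> Y (p + x - 1 - k) = c (x - 1 - k) &
      j <= maxn x (L - x)].

Lemma search_next x p j : search_inv x p j -> j < maxn x (L - x) ->
  (x + j < L -> Y (p + x + j) = c (x + j)) ->
  (j < x -> Y (p + x - 1 - j) = c (x - 1 - j)) -> search_inv x p j.+1.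
Proof.
move=> [h1 h2 h3 h4 h5] h6 h7 h8; split => //.
- by move=> k; rewrite ltnS leq_eqVlt => /orP[/eqP->|/h3].
- by move=> k; rewrite ltnS leq_eqVlt => /orP[/eqP->|/h4].
Qed.

Lemma search_restart x p j p' : search_inv x p j -> search_inv x p' 0.
Proof. by move=> [h1 h2 _ _ _]. Qed.

Lemma search_shift x p j : search_inv x p j ->
  (x + j < L /\ Y (p + x + j) <> c (x + j)) \/
  (j < x /\ Y (p + x - 1 - j) <> c (x - 1 - j)) ->
  no_occ p (p + j.+1).
Proof.
move=> [h1 h2 h3 h4 h5] bad s hs os.
have := @crit_cut_shift c L Y x p j h2 h3 (ltnW h1) bad (s - p) ltac:(lia).
by rewrite subnKC //; lia.
Qed.

Lemma search_found x p : search_inv x p (maxn x (L - x)) -> occ p.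
Proof.
move=> [h1 h2 h3 h4 h5] t tL; case: (leqP x t) => h.
  by have := h3 (t - x); rewrite -addnA subnKC // => ->; lia.
have := h4 (x - 1 - t) ltac:(lia) ltac:(lia).
have -> : x - 1 - (x - 1 - t) = t by lia.
by move=> <-; congr Y; lia.
Qed.

Lemma no_occ_cat a b d : no_occ a b -> no_occ b d -> no_occ a d.
Proof.
by move=> h1 h2 s hs; case: (ltnP s b) => h; [apply: h1|apply: h2]; lia.
Qed.

Definition gap q a := [/\ 0 < q, 2 * q <= m, occ a, occ (a + q) &
  forall s, 0 < s < q -> ~ occ (a + s)].

Lemma gapDm q a : gap q a -> gap q (a + 2 * m).
Proof.
have D s : occ (a + 2 * m + s) <-> occ (a + s).
  have -> : a + 2 * m + s = a + s + m + m by lia.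
  by split=> [/occDm/occDm|h] //; apply/occDm/occDm.
move=> [h1 h2 h3 h4 h5]; split => //.
- by have := D 0; rewrite !addn0 => h; apply/h.
- exact/D.
- by move=> s hs /D; apply: h5.
Qed.

Lemma gap_periodic q a : gap q a -> forall u, a <= u < a + L -> Y u = Y (u + q).
Proof.
move=> [h1 h2 h3 h4 h5] u hu.
have := h3 (u - a) ltac:(lia); have := h4 (u - a) ltac:(lia).
rewrite subnKC => [e1 e2|]; last lia.
by rewrite e2 -e1; congr Y; lia.
Qed.

Lemma searched_gap g pv p : searched g pv p -> g <> 0 -> occ p ->
  2 * (p - pv) <= m -> gap (p - pv) pv /\ pv < 2 * m.
Proof.
case: g => [|[|[|g]]] //=.
  move=> [h1 h2 h3 h4] _ op h5; split; last lia.
  split => //; [lia|by rewrite subnKC //; lia|].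
  by move=> s hs; apply: h4; lia.
move=> [pv0 [h1 h2 _ h4 [h5 h6 h7 h8]]] _ op h9.
have := no_occ_le h2 h4; split; last lia.
split => //; [lia|by rewrite subnKC //; lia|].
by move=> s hs; apply: h8; lia.
Qed.

Lemma searched_le g pv p : searched g pv p -> 0 < g -> 
  [/\ g <= 2, occ pv, pv < 2 * m, pv < p & p <= pv + m /\ no_occ pv.+1 p].
Proof.
case: g => [|[|[|g]]] //=.
  move=> [h1 h2 h3 h4] _; have := no_occ_le h2 h4; split => //; lia.
move=> [pv0 [h1 h2 h3 h4 [h5 h6 h7 h8]]] _.
by have := no_occ_le h2 h4; have := no_occ_le h6 h8; split => //; lia.
Qed.

Definition unique_reading A := forall b, occ b -> forall t, Y (b + t) = Y (A + t).

(* Occurrences repeat with period [m], so gaps above [m / 2] can only be [m]. *)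
Lemma searched_unique pv p : searched 2 pv p -> occ p -> m < 2 * (p - pv) ->
  unique_reading (pv + 2 * m).
Proof.
move=> [pv0 [h1 h2 h3 h4 [h5 h6 h7 h8]]] op h9 b ob t.
have e0 := no_occ_le h2 h4; have e1 := no_occ_le h6 h8.
have e2 : pv = pv0 + m.
  apply/eqP; rewrite eqn_leq e0 leqNgt; apply/negP => lt.
  by apply: (h8 (pv0 + m)); [lia | apply/occDm].
have m_gt0 : 0 < m by lia.
have [d [dm E]] : exists d, d < m /\ eqmod m (pv0 + d) b.
  exists ((b + pv0 * m - pv0) %% m); rewrite ltn_pmod // /eqmod modnDmr; split => //.
  have h : pv0 <= pv0 * m by rewrite leq_pmulr.
  by rewrite subnKC ?(leq_trans h) ?leq_addl // addnC modnMDl.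
have ob' : occ (pv0 + d) by apply: (occurs_modn Yper) ob; rewrite E.
have d0 : d = 0.
  case: (posnP d) => // d0; exfalso; apply: (h4 (pv0 + d)) ob'; lia.
apply: (cyclic_fun_modn Yper); rewrite -modnDml -E d0 addn0 modnDml e2.
have -> : pv0 + m + 2 * m + t = 3 * m + (pv0 + t) by lia.
by rewrite modnMDl.
Qed.

(** Without a break in [m] consecutive positions, [q] is a period of all of [P^omega], and the first
    [q] letters of the core fix everything read from an occurrence. *)
Lemma gap_all_unique q a : gap q a ->
  (forall u, a <= u < a + m -> Y u = Y (u + q)) -> unique_reading (a + 2 * m).
Proof.
move=> [h1 h2 h3 h4 h5] H.
have m_gt0 : 0 < m by lia.
have Hall u : Y u = Y (u + q).
  have [d [dm E]] : exists d, d < m /\ eqmod m (a + d) u.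
    exists ((u + a * m - a) %% m); rewrite ltn_pmod // /eqmod modnDmr; split => //.
    have h : a <= a * m by rewrite leq_pmulr.
    by rewrite subnKC ?(leq_trans h) ?leq_addl // addnC modnMDl.
  rewrite -(cyclic_fun_modn Yper E) H; last lia.
  by apply: (cyclic_fun_modn Yper); rewrite -modnDml E modnDml.
have Hper lo hi : periodic_on Y q lo hi by move=> t _ _.
have first b t : occ b -> Y (b + t) = c (t %% q).
  move=> ob; have tq : t %% q < q by rewrite ltn_pmod.
  rewrite -(ob (t %% q)); last by apply: leq_trans tq _; lia.
  rewrite {1}(divn_eq t q) addnCA [t %/ q * q + _]addnC.
  by symmetry; apply: (@periodic_on_mul _ _ 0 (b + t %% q + t %/ q * q).+1).
move=> b ob t; rewrite (first _ _ ob) -(first a) //.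
apply: (cyclic_fun_modn Yper); have -> : a + 2 * m + t = 2 * m + (a + t) by lia.
by rewrite modnMDl.
Qed.

Definition run_inv q A0 al be := [/\ gap q A0, 2 * m <= A0 < 4 * m,
  periodic_on Y q al be, [/\ A0 < al + m, al <= A0, A0 + q + L <= be & be <= A0 + m + q] &
  Y al.-1 <> Y (al.-1 + q) /\ Y (be - q) <> Y be].

Definition right_inv q A0 be := [/\ gap q A0, 2 * m <= A0 < 4 * m,
  periodic_on Y q A0 be, A0 + q + L <= be <= A0 + m + q & Y (be - q) <> Y be].

Lemma right_stop q a t : gap q a -> a < 2 * m -> a <= t < a + m ->
  (forall u, a <= u < t -> Y u = Y (u + q)) -> Y t <> Y (t + q) ->
  right_inv q (a + 2 * m) (t + q + 2 * m).
Proof.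
move=> G a2 ht H ne.
have Y2 u : Y (u + 2 * m) = Y u.
  by rewrite (_ : u + 2 * m = u + m + m) ?Yper //; lia.
split; [exact: gapDm|lia| | |].
- move=> u h1 h2; have := H (u - 2 * m) ltac:(lia).
  rewrite -(Y2 (u - _)) -(Y2 (u - _ + q)); have -> : u - 2 * m + 2 * m = u by lia.
  by move=> ->; congr Y; lia.
- suff : a + L <= t by lia.
  rewrite leqNgt; apply/negP => h; case: ne; apply: gap_periodic G _ _; lia.
- have -> : t + q + 2 * m - q = t + 2 * m by lia.
  by rewrite !Y2.
Qed.

Lemma left_stop q A0 be t : right_inv q A0 be -> be < t + m + q -> t <= A0 ->
  (forall u, t <= u < A0 -> Y u = Y (u + q)) -> Y (t - 1) <> Y (t - 1 + q) ->
  run_inv q A0 t be.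
Proof.
move=> [h1 h2 h3 h4 h5] h6 h7 H ne; split => //.
- by move=> u hu hu'; case: (ltnP u A0) => h; [apply: H|apply: h3]; lia.
- by split; lia.
- by rewrite -subn1.
Qed.

(** The break between [be - q] and [be] recurs [m] positions earlier and stops the scan to the
    left. *)
Lemma left_bound q A0 be t : right_inv q A0 be -> be < t.+1 + m + q -> t < A0 ->
  Y t = Y (t + q) -> be < t + m + q.
Proof.
move=> [h1 h2 h3 h4 h5] h6 h7 e.
rewrite ltn_neqAle; apply/andP; split; last lia.
apply/eqP => h8; case: h5.
have -> : be - q = t + m by lia.
by rewrite h8 Yper e -Yper; congr Y; lia.
Qed.

(** When all alignments read the same letters, [r = X + 1] sends every window, as [e <= X], to the
    test of the single alignment [A1]. Otherwise [r = 0] or [r + B = X] means that no window starts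
    before [r]. *)
Definition ready r A1 q A0 al be :=
  [/\ r = X + 1, 2 * m <= A1 < 4 * m & unique_reading A1] \/
  [/\ run_inv q A0 al be, X <= r + B /\ r <= X,
      r = 0 \/ r + B = X \/ Tt (r - 1) <> Tt (r - 1 + q),
      forall u, r <= u < X -> Tt u = Tt (u + q) & A1 = al + X - r].

Lemma ready_bounds r A1 q A0 al be : ready r A1 q A0 al be -> m <= A1 < 5 * m.
Proof.
case=> [[h1 h2 h3]|[h1 h2 h3 h4 ->]]; first lia.
by case: h1 => _ h5 _ [h6 h7 h8 h9] _; lia.
Qed.

Definition left_stop_at A1 l :=
  l = 0 \/ l + B = X \/ Tt (l - 1) <> Y (A1 + l - (X + 1)).

Definition engine (q A1 be h d1 ra A2 d2 : nat) :=
  (d1 = 0 <-> aligned Y Tt X A1 (X + L) h) /\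
  if ra == 0 then d2 = 0 /\ forall u, X + L <= u < h -> Tt u = Tt (u - q)
  else exists h0, [/\ X + L <= h0 < h, forall u, X + L <= u < h0 -> Tt u = Tt (u - q),
    Tt h0 <> Tt (h0 - q), A2 = be + X - h0 & d2 = 0 <-> aligned Y Tt X A2 h0 h].

Lemma alignedS A a b : a <= b ->
  aligned Y Tt X A a b.+1 <-> aligned Y Tt X A a b /\ Tt b = Y (A + b - X).
Proof.
move=> ab; split=> [h|[h1 h2] u hu].
  by split; [move=> u hu; apply: h; lia | apply: h; lia].
by case: (eqVneq u b) => [->|] // ne; apply: h1; lia.
Qed.

Lemma engine_init q A1 be A2 : engine q A1 be (X + L) 0 0 A2 0.
Proof. by split; [split => // _ u; lia | split => // u; lia]. Qed.

(** The letter at which the text run breaks is already compared under the alignment [A2] that it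
    determines. *)
Lemma engine_step q A1 be h d1 ra A2 d2 : X + L <= h ->
  engine q A1 be h d1 ra A2 d2 ->
  let brk := (ra == 0) && (Tt h != Tt (h - q)) in
  let ra' := if brk then 1 else ra in
  let A2' := if brk then be + X - h else A2 in
  let d2' := if (ra' != 0) && (Tt h != Y (A2' + h - X)) then 1 else d2 in
  engine q A1 be (h + 1) (if Tt h == Y (A1 + h - X) then d1 else 1) ra' A2' d2'.
Proof.
move=> hh [hd1 hra] /=; rewrite addn1; split.
  rewrite alignedS //; case: eqP => e; last by split=> // [[]].
  by rewrite hd1; split=> [|[]].
case: eqP hra => ra0 /=.
  move=> [d20 H]; subst d2; case: (Tt h =P Tt (h - q)) => e /=.
    rewrite ra0 /=; split=> // u hu.
    by case: (eqVneq u h) => [-> //|ne]; apply: H; lia.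
  exists h; split => //; first lia.
  rewrite alignedS //; case: (_ =P Y _) => e' /=; split => //; last by case.
  by move=> _; split => // u; lia.
have -> : (ra == 0) = false by apply/eqP.
move=> [h0 [k1 k2 k3 k4 k5]] /=; exists h0; split => //; first lia.
rewrite alignedS; last lia.
by case: (_ =P Y _) => e /=; rewrite ?k5; split=> [|[]].
Qed.

Lemma no_occ_all p : m <= p -> no_occ 0 p -> forall s, ~ occ s.
Proof.
move=> mp h s os; have m_gt0 : 0 < m by lia.
apply: (h (s %% m)); first by have := ltn_pmod s m_gt0; lia.
by apply: (occurs_modn Yper) os; rewrite modn_mod.
Qed.

(** The branches follow [window_left_break], [window_in_run] and [window_right_break]; the first
    also serves the case of a unique reading. *)
Definition answer (q A0 al be r l d1 ra A2 d2 e : nat) :=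
  if e < r then (l <= e) && (d1 == 0) else
  if ra == 0 then
    al + (((A0 - al) %% q + q - (X - e) %% q) %% q) + m <= be
  else [&& A2 %% q == A0 %% q, X + al <= A2 + e & d2 == 0].

Lemma answer_correct q A0 al be r A1 l d1 ra A2 d2 e :
  ready r A1 q A0 al be -> l <= X + L -> aligned Y Tt X A1 l (X + L) ->
  left_stop_at A1 l -> engine q A1 be (e + m) d1 ra A2 d2 ->
  e <= X -> X < e + B ->
  answer q A0 al be r l d1 ra A2 d2 e <-> cyclic_window m Y Tt e.
Proof.
move=> rd lL al1 stop [hd1 hra] eX Xe; have m_gt0 : 0 < m by lia.
have eb := ready_bounds rd; have XeB : X - e < B by lia.
have A1P : reflect (aligned Y Tt X A1 e (e + m)) ((l <= e) && (d1 == 0)).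
  apply: (iffP andP) => [[h1 /eqP/hd1 h2]|h].
    move=> u hu; case: (ltnP u (X + L)) => hX; [apply: al1|apply: h2]; lia.
  split; last by apply/eqP/hd1 => u hu; apply: h; lia.
  rewrite leqNgt; apply/negP => el; case: stop => [|[]]; [lia|lia|].
  by case; rewrite h; [congr Y|]; lia.
rewrite /answer.
case: rd => [[h1 h2 h3]|[[G h0 run [b1 b2 b3 b4] [n1 n2]] h2 h3 h4 h5]].
  have -> : e < r by lia.
  split=> [/A1P h|h]; first by apply: (aligned_window m8 m_gt0 defL) h; lia.
  by apply/A1P; apply: (aligned_window_unique m8 m_gt0 defL Yper) => //; lia.
case: G => q0 q2 o0 o1 oN.
have A0m : 2 * m <= A0 by lia.
have pT : periodic_on Tt q r (X + L).
  move=> t ht1 ht2; case: (ltnP t X) => h; first by apply: h4; lia.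
  have hc : periodic_on (fun t => Tt (X + t)) q 0 L.
    exact: (core_periodic m8 m_gt0 defL q0 q2 o0 o1 A0m b1 b2 b3 n1 n2).
  have := hc (t - X) ltac:(lia) ltac:(lia).
  by rewrite subnKC // => ->; congr Tt; lia.
case: ltnP => er.
  have brk : Tt r.-1 <> Tt (r.-1 + q) by case: h3 => [|[]]; [lia|lia|rewrite -subn1].
  have W := @window_left_break m B L Y Tt X m8 m_gt0 defL Yper q A0 al be
    q0 q2 o0 o1 oN A0m run b1 b2 b3 n1 n2 e eX XeB r ltac:(lia) brk pT.
  split=> [/A1P h|h]; first by apply/W; rewrite -h5.
  by apply/A1P; rewrite h5; apply/W.
have pT' h : X + L <= h -> (forall u, X + L <= u < h -> Tt u = Tt (u - q)) ->
    periodic_on Tt q e h.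
  move=> hh H t t1 t2; case: (ltnP (t + q) (X + L)) => h6; first by apply: pT; lia.
  by rewrite (H (t + q)) ?addnK //; lia.
case: eqP hra => ra0 hra.
  case: hra => _ hra.
  have pW := pT' (e + m) ltac:(lia) hra.
  have [s1 s2] := phase_modn q0 b2 (X - e).
  have W := @window_in_run m B L Y Tt X m8 m_gt0 defL Yper q A0 al be
    q0 q2 o0 o1 oN A0m run b1 b2 b3 n1 n2 e eX XeB _ s1 s2 pW.
  exact: iff_sym W.
have [h [hh1 hh2 hh3 hh4 hh5]] := hra.
have pW := pT' h ltac:(lia) hh2.
have W := @window_right_break m B L Y Tt X m8 m_gt0 defL Yper q A0 al be
    q0 q2 o0 o1 oN A0m run b1 b2 b3 n1 n2 e eX XeB h pW
    (fun E => hh3 (esym E)) ltac:(lia).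
rewrite -hh4 in W; split=> [/and3P[/eqP h6 h7 /eqP/hh5 h8]|/W[h6 h7 h8]].
  by apply/W.
by apply/and3P; split => //; apply/eqP => //; apply/hh5.
Qed.

End SearchLoop.

(** * The program *)

Declare Scope prog_scope.
Delimit Scope prog_scope with prog.
Notation "a + b" := (Bin Plus a b) : prog_scope.
Notation "a - b" := (Monus a b) : prog_scope.
Notation "a %/ b" := (Bin Quo a b) : prog_scope.
Notation "a %% b" := (Bin Rem a b) : prog_scope.
Notation "a < b" := (Bin Less a b) : prog_scope.
Notation "a == b" := (Bin Same a b) : prog_scope.
Notation "v ::= e" := (Asg v e%prog) (at level 90) : prog_scope.
Notation "s1 ;; s2" := (Seq s1 s2) (at level 92, right associativity) : prog_scope.
Notation "# n" := (Cst n) (at level 5, format "# n") : prog_scope.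

(* The core is [T[X..X+L)].  Phases 0 and 1 compare its suffixes at A and B on K
   letters; phase 2 tries alignment P with J comparisons around the cut C and
   keeps the previous alignment Pv; phases 3 and 4 delimit the run [Al, Be) of
   period Q around the alignment A0 in [P^omega]; phase 5 finds the start R of
   the run of the text; phase 6 extends the alignment A1, for which the starts of
   both runs meet, to the left up to L.  In phase 7 position H of the text is
   read; D1 and D2 flag mismatches under A1 and A2, where A2 makes the ends of
   both runs meet and is set, together with Ra, when the run of the text breaks. *)
Notation rPh := 0 (only parsing).
Notation rX := 1 (only parsing).
Notation rA := 2 (only parsing).
Notation rB := 3 (only parsing).
Notation rK := 4 (only parsing).
Notation rC := 5 (only parsing).
Notation rP := 6 (only parsing).
Notation rJ := 7 (only parsing).
Notation rG := 8 (only parsing).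
Notation rPv := 9 (only parsing).
Notation rQ := 10 (only parsing).
Notation rA0 := 11 (only parsing).
Notation rAl := 12 (only parsing).
Notation rBe := 13 (only parsing).
Notation rR := 14 (only parsing).
Notation rA1 := 15 (only parsing).
Notation rL := 16 (only parsing).
Notation rH := 17 (only parsing).
Notation rD1 := 18 (only parsing).
Notation rRa := 19 (only parsing).
Notation rA2 := 20 (only parsing).
Notation rD2 := 21 (only parsing).

Notation vPh := (Var rPh) (only parsing).
Notation vX := (Var rX) (only parsing).
Notation vA := (Var rA) (only parsing).
Notation vB := (Var rB) (only parsing).
Notation vK := (Var rK) (only parsing).
Notation vC := (Var rC) (only parsing).
Notation vP := (Var rP) (only parsing).
Notation vJ := (Var rJ) (only parsing).
Notation vG := (Var rG) (only parsing).
Notation vPv := (Var rPv) (only parsing).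
Notation vQ := (Var rQ) (only parsing).
Notation vA0 := (Var rA0) (only parsing).
Notation vAl := (Var rAl) (only parsing).
Notation vBe := (Var rBe) (only parsing).
Notation vR := (Var rR) (only parsing).
Notation vA1 := (Var rA1) (only parsing).
Notation vL := (Var rL) (only parsing).
Notation vH := (Var rH) (only parsing).
Notation vD1 := (Var rD1) (only parsing).
Notation vRa := (Var rRa) (only parsing).
Notation vA2 := (Var rA2) (only parsing).
Notation vD2 := (Var rD2) (only parsing).

Section Program.
Local Open Scope prog_scope.

Definition blockE := PLen %/ #8.
Definition coreE := PLen - (blockE + blockE).
Definition cycE e := PAt (e %% PLen).

(** Phase 1 uses the opposite letter order: where [u] and [v] differ, comparing the test [v < u]
    with the phase reverses it. *)
Definition step_maxsuf :=
  let u := TAt (vX + (vA + vK)) in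
  let v := TAt (vX + (vB + vK)) in
  If (vB + vK < coreE)
    (If (u == v) (rK ::= vK + #1)
      (If ((v < u) == (vPh == #0))
        (rB ::= vB + (vK + #1) ;; rK ::= #0)
        (If (vA + vK < vB) (rA ::= vB) (rA ::= vA + (vK + #1)) ;;
         rB ::= vA + #1 ;; rK ::= #0)))
    (If (vPh == #0)
      (rC ::= vA ;; rA ::= #0 ;; rB ::= #1 ;; rK ::= #0 ;; rPh ::= #1)
      (If (vC < vA) (rC ::= vA) Skip ;; rPh ::= #2)).

Definition set_unique :=
  rA1 ::= vPv + (PLen + PLen) ;; rL ::= vX + coreE ;; rPh ::= #6.

(** There is no short-circuit evaluation, so letters outside the core are read too; on truth values
    [a < b] means not [a] and [b], which masks them. *)
Definition step_search :=
  let bad1 := (cycE (vP + vC + vJ) == TAt (vX + (vC + vJ))) < (vJ < coreE - vC) in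
  let bad2 := (cycE (vP + vC - (vJ + #1)) == TAt (vX + (vC - (vJ + #1)))) < (vJ < vC) in
  If (vG + (vP < PLen))
    (If ((vJ < vC) + (vJ < coreE - vC))
      (If (bad1 + bad2) (rP ::= vP + (vJ + #1) ;; rJ ::= #0) (rJ ::= vJ + #1))
      (If (vG == #0)
        (rPv ::= vP ;; rG ::= #1 ;; rP ::= vP + #1 ;; rJ ::= #0)
        (If (PLen < (vP - vPv) + (vP - vPv))
          (If (vG == #2) set_unique
            (rPv ::= vP ;; rG ::= #2 ;; rP ::= vP + #1 ;; rJ ::= #0))
          (rQ ::= vP - vPv ;; rA ::= vPv ;; rPh ::= #3))))
    (rD1 ::= #1 ;; rH ::= vX + coreE ;; rPh ::= #7).

Definition step_right :=
  If (vA - vPv < PLen)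
    (If (cycE vA == cycE (vA + vQ)) (rA ::= vA + #1)
      (rBe ::= vA + vQ + (PLen + PLen) ;; rA0 ::= vPv + (PLen + PLen) ;;
       rA ::= vPv + (PLen + PLen) ;; rPh ::= #4))
    set_unique.

Definition step_left :=
  If (cycE (vA - #1) == cycE (vA - #1 + vQ)) (rA ::= vA - #1)
    (rAl ::= vA ;; rR ::= vX ;; rPh ::= #5).

Definition step_text_left :=
  If ((#0 < vR) + (vX < vR + blockE) + (TAt (vR - #1) == TAt (vR - #1 + vQ)) == #3)
    (rR ::= vR - #1)
    (rA1 ::= vAl + vX - vR ;; rL ::= vX + coreE ;; rPh ::= #6).

Definition step_align_left :=
  If ((#0 < vL) + (vX < vL + blockE) +
      (TAt (vL - #1) == cycE (vA1 + vL - (vX + #1))) == #3)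
    (rL ::= vL - #1)
    (rH ::= vX + coreE ;; rPh ::= #7).

Definition step_engine :=
  If (vH < TLen)
    (If (TAt vH == cycE (vA1 + vH - vX)) Skip (rD1 ::= #1) ;;
     If (vRa == #0)
       (If (TAt vH == TAt (vH - vQ)) Skip (rRa ::= #1 ;; rA2 ::= vBe + vX - vH))
       Skip ;;
     If vRa (If (TAt vH == cycE (vA2 + vH - vX)) Skip (rD2 ::= #1)) Skip ;;
     rH ::= vH + #1)
    Skip.

Definition micro :=
  If (vPh < #2) step_maxsuf
  (If (vPh == #2) step_search
  (If (vPh == #3) step_right
  (If (vPh == #4) step_left
  (If (vPh == #5) step_text_left
  (If (vPh == #6) step_align_left step_engine))))).

(** The phases before 7 take at most [15 * m + 8 <= 233 * B] steps, because [m < 8 * B + 8] and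
    [B >= 1]. The remaining steps let the engine catch up with the text before the first window has
    to be answered. *)
Definition speed := 256.

Definition micros := iter speed (Seq micro) Skip.

Definition ageE (k : nat) :=
  (TLen - #1 + (if k is 0 then #0 else blockE)) %% (blockE + blockE) + #1.

(** [R] starts beyond every window start of the job and stays there unless a run is found. *)
Definition reset :=
  foldr (fun v s => Seq (Asg v (#0)) s)
    (rX ::= TLen + (blockE + blockE) - (PLen + #1) ;; rB ::= #1 ;; rR ::= vX + #1)
    (iota 0 22).

Definition startE := TLen - PLen.

Definition decide :=
  let yes := Out startE in
  If (startE < vR)
    (If ((vL < startE + #1) + (vD1 == #0) == #2) yes Skip)
    (If (vRa == #0)
      (If (vBe < vAl + ((vA0 - vAl) %% vQ + vQ - (vX - startE) %% vQ) %% vQ + PLen)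
         Skip yes)
      (If ((vA2 %% vQ == vA0 %% vQ) + (vX + vAl < vA2 + startE + #1) + (vD2 == #0) == #3)
         yes Skip)).

(** The first test idles the slot while the core would begin before the text, so the subtraction in
    [reset] is exact. *)
Definition slot k :=
  If (TLen + (blockE + blockE) < PLen + ageE k) Skip
    (If (ageE k == #1) reset Skip ;; micros ;;
     If (blockE < ageE k) (If (TLen < PLen) Skip decide) Skip).

Definition allE (f : nat -> expr) n :=
  foldr (fun j e => ((e == #0) + (f j == #0)) == #0) (#1) (iota 0 n).

Definition anyE (f : nat -> expr) n := foldr (fun j e => e + f j) (#0) (iota 0 n).

(** On truth values [a < b + 1] is the implication from [a] to [b], so offsets beyond the pattern
    pass. *)
Definition bruteE :=
  anyE (fun D => allE (fun j =>
    (#j < PLen) < (cycE (#D + #j) == TAt (startE + #j)) + #1) 8) 8.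

Definition brute := If (TLen < PLen) Skip (If bruteE (Out startE) Skip).

Definition bank k := If (PLen < #8) (if k is 0 then brute else Skip) (slot k).

End Program.

Arguments upd E v x u /.

(** * Correctness of a job *)

Lemma nz_bool (b : bool) : ((b : nat) != 0) = b.
Proof. by case: b. Qed.

Lemma nz_addb (a b : bool) : (a + b != 0) = a || b.
Proof. by case: a; case: b. Qed.

Lemma nz_add n (b : bool) : (n + b != 0) = (n != 0) || b.
Proof. by case: b; lia. Qed.

Lemma ltb_bool (a b : bool) : (a < b) = ~~ a && b.
Proof. by case: a; case: b. Qed.

Lemma eqb_bool (a b : bool) : ((a : nat) == b) = (a == b).
Proof. by case: a; case: b. Qed.

Lemma addb_eq2 (a b : bool) : (a + b == 2) = a && b.
Proof. by case: a; case: b. Qed.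

Lemma addb_eq3 (a b c : bool) : (a + b + c == 3) = [&& a, b & c].
Proof. by case: a; case: b; case: c. Qed.

Definition condE := (nz_bool, addb_eq2, addb_eq3, nz_addb, nz_add, ltb_bool, eqb_bool).

Lemma upd_le E v x U : (forall u, E u <= U) -> x <= U -> forall u, upd E v x u <= U.
Proof. by move=> h1 h2 u /=; case: Nat.eqb. Qed.

(* A wrapper that hides the quotient from [lia]. *)
Definition block_size m B : Prop := B = m %/ 8.

Lemma block_sizeP m B : block_size m B -> 8 <= m ->
  [/\ 0 < B, 8 * B <= m & m < 8 * B + 8].
Proof.
move=> -> m8; split; first by rewrite divn_gt0.
  by rewrite mulnC leq_divM.
by rewrite -mulnSr mulnC -ltn_divLR.
Qed.

Ltac bound_upd :=
  repeat match goal with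
  | |- forall u, is_true (upd _ _ _ u <= _) => apply: upd_le
  end; try assumption; rewrite /=; lia.

Ltac upd_ext :=
  let v := fresh in
  move=> v /=;
  repeat match goal with
  | |- context [Nat.eqb v ?n] =>
      case: (PeanoNat.Nat.eqb_spec v n) => ?; first by subst v
  end.

Section Job.

Variables (P T : seq nat) (m B L N X : nat).
Let Y t := nth 0 P (t %% m).
Let Tt u := nth 0 T u.
Let c t := Tt (X + t).
Notation occ := (occurs c L Y).

Hypotheses (defm : size P = m) (defB : block_size m B) (defL : L = m - 2 * B).
Hypotheses (hB0 : 0 < B) (hB1 : 8 * B <= m) (mN : m + size T <= N).

Lemma Yper t : Y (t + m) = Y t. Proof. by rewrite /Y modnDr. Qed.

Definition quiet (E : nat -> nat) := [/\ E rD1 = 0, E rRa = 0 & E rD2 = 0].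

(** The bounds on the number [s] of steps made so far are an amortized analysis: in each phase
    before 7 a potential grows with every step. In phase 2 a mismatch moves the [J] comparisons into
    [P], and [G * L] pays for dropping [J] when an alignment is recorded. In phase 7 either the
    engine lags by at most [z] letters, or the steps so far are covered by the earlier phases and
    the letters it has read. *)
Definition phase_inv (z s i : nat) (E : nat -> nat) : Prop :=
  match E rPh with
  | 0 => [/\ maxsuf_inv c L false (E rA) (E rB) (E rK),
             [/\ E rP = 0, E rJ = 0 & E rG = 0], E rR = X + 1, quiet E &
             s <= E rA + E rB + E rK]
  | 1 => [/\ maxsuf_inv c L true (E rA) (E rB) (E rK) /\
               max_suffix c L false (E rC),
             [/\ E rP = 0, E rJ = 0 & E rG = 0], E rR = X + 1, quiet E &
             s <= 2 * L + 1 + (E rA + E rB + E rK)]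
  | 2 => [/\ search_inv L Y Tt X (E rC) (E rP) (E rJ),
             searched m L Y Tt X (E rG) (E rPv) (E rP) /\ E rP <= 3 * m,
             E rR = X + 1, quiet E &
             s <= 4 * L + 3 + (E rP + E rJ + E rG * L)]
  | 3 => [/\ gap m L Y Tt X (E rQ) (E rPv) /\ E rPv < 2 * m,
             E rPv <= E rA <= E rPv + m /\
               (forall u, E rPv <= u < E rA -> Y u = Y (u + E rQ)),
             E rR = X + 1, quiet E &
             s <= 10 * m + 4 + (E rA - E rPv)]
  | 4 => [/\ right_inv m L Y Tt X (E rQ) (E rA0) (E rBe),
             E rA <= E rA0 /\ E rBe < E rA + m + E rQ,
             (forall u, E rA <= u < E rA0 -> Y u = Y (u + E rQ)),
             quiet E &
             s <= 11 * m + 5 + (E rA0 - E rA)]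
  | 5 => [/\ run_inv m L Y Tt X (E rQ) (E rA0) (E rAl) (E rBe),
             X <= E rR + B /\ E rR <= X,
             (forall u, E rR <= u < X -> Tt u = Tt (u + E rQ)),
             quiet E &
             s <= 12 * m + 6 + (X - E rR)]
  | 6 => [/\ ready m B L Y Tt X (E rR) (E rA1) (E rQ) (E rA0) (E rAl) (E rBe),
             X <= E rL + B /\ E rL <= X + L,
             aligned Y Tt X (E rA1) (E rL) (X + L),
             quiet E &
             s <= 13 * m + 7 + (X + L - E rL)]
  | 7 => [/\ X + L <= E rH <= i,
             i <= E rH + z \/ s <= 15 * m + 8 + (E rH - (X + L)) &
             [/\ E rR = X + 1, E rD1 <> 0 & forall p, ~ occ p] \/
             [/\ ready m B L Y Tt X (E rR) (E rA1) (E rQ) (E rA0) (E rAl) (E rBe),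
                 E rL <= X + L, aligned Y Tt X (E rA1) (E rL) (X + L),
                 left_stop_at B Y Tt X (E rA1) (E rL) &
                 engine L Y Tt X (E rQ) (E rA1) (E rBe) (E rH) (E rD1) (E rRa)
                   (E rA2) (E rD2)]]
  | _ => False
  end.

(** The bound on [Be] holds in all phases because the engine computes [A2] from it, which must stay
    below [8 * N]. *)
Definition job_inv z s i E :=
  [/\ E rX = X, forall v, E v <= 8 * N, E rBe <= 6 * m & phase_inv z s i E].

Variables (z i : nat).
Hypotheses (yi : X + L <= i) (iT : i <= size T).
Let T' := take i T.

Lemma text_at u : u < i -> nth 0 T' u = Tt u.
Proof. by move=> h; rewrite /T' nth_take. Qed.

Lemma blockE_eq : m %/ 8 = B. Proof. by rewrite defB. Qed.
Lemma coreE_eq : m - (B + B) = L. Proof. by rewrite defL addnn mul2n. Qed.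
Lemma cycE_eq x : nth 0 P (x %% m) = Y x. Proof. by []. Qed.

Let denE := (defm, blockE_eq, coreE_eq, cycE_eq).

Lemma step_maxsuf_inv s E : job_inv z s i E -> E rPh < 2 ->
  job_inv z.-1 s.+1 i (exec P T' step_maxsuf E).
Proof.
move=> [hX hb hbe hph] h2.
have [inv [hz hR hq] bs] : [/\ maxsuf_inv c L (E rPh != 0) (E rA) (E rB) (E rK),
   [/\ [/\ E rP = 0, E rJ = 0 & E rG = 0], E rR = X + 1 & quiet E] &
   (E rPh = 0 /\ s <= E rA + E rB + E rK) \/
   [/\ E rPh = 1, s <= 2 * L + 1 + (E rA + E rB + E rK) & max_suffix c L false (E rC)]].
  move: hph h2; rewrite /phase_inv; case: (E rPh) => [|[|//]] /=.
    by move=> [h1 h3 h4 h5 h6] _; split => //; left.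
  by move=> [[h1 h1'] h3 h4 h5 h6] _; split => //; right.
have nL : L <= 8 * N by lia.
have [i1 i2 i3 i4] := inv.
rewrite /step_maxsuf /= !denE !condE hX.
case: ifP => hk.
  rewrite !text_at; [|lia|lia].
  rewrite -/(c (E rA + E rK)) -/(c (E rB + E rK)).
  case: eqP => e1.
    have inv' : maxsuf_inv c L (E rPh != 0) (E rA) (E rB) (E rK + 1).
      by rewrite addn1; apply: maxsuf_eq.
    split => //; first by bound_upd.
    rewrite /phase_inv /=; case: bs => [[p0 bs]|[p0 bs mx]]; move: inv'; rewrite p0 => inv'.
      by split => //=; lia.
    by split => //=; lia.
  case: eqP => e2.
    have inv' : maxsuf_inv c L (E rPh != 0) (E rA) (E rB + (E rK + 1)) 0.
      rewrite addn1; apply: (maxsuf_keep inv hk); rewrite /letter_lt; case: ifP => hp.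
        by move: e2; rewrite (negbTE hp); lia.
      by move: e2; rewrite -[E 0 == 0]negbK hp; lia.
    have [j1 j2 _ _] := inv'.
    split => //; first by bound_upd.
    rewrite /phase_inv /=; case: bs => [[p0 bs]|[p0 bs mx]]; move: inv'; rewrite p0 => inv'.
      by split => //=; lia.
    by split => //=; lia.
  have inv' : maxsuf_inv c L (E rPh != 0) (maxn (E rA + (E rK).+1) (E rB))
      (maxn (E rA + (E rK).+1) (E rB) + 1) 0.
    apply: (maxsuf_switch inv hk); rewrite /letter_lt; case: ifP => hp.
      by move: e2; rewrite (negbTE hp); lia.
    by move: e2; rewrite -[E 0 == 0]negbK hp; lia.
  have [j1 j2 _ _] := inv'.
  have [mE|mE] := ltnP (E rA + E rK) (E rB).
    have me : maxn (E rA + (E rK).+1) (E rB) = E rB by lia.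
    rewrite me in inv' j1 j2.
    split => //; first by bound_upd.
    rewrite /phase_inv /=; case: bs => [[p0 bs]|[p0 bs mx]]; move: inv'; rewrite p0 => inv'.
      by split => //=; lia.
    by split => //=; lia.
  have me : maxn (E rA + (E rK).+1) (E rB) = E rA + (E rK + 1) by lia.
  rewrite me in inv' j1 j2.
  split => //; first by bound_upd.
  rewrite /phase_inv /=; case: bs => [[p0 bs]|[p0 bs mx]]; move: inv'; rewrite p0 => inv'.
    by split => //=; lia.
  by split => //=; lia.
have mx1 := maxsuf_end inv ltac:(lia).
case: bs => [[p0 bs]|[p0 bs mx]]; move: inv mx1; rewrite p0 /= => inv mx1.
  split => //; first by bound_upd.
  rewrite /phase_inv /=; split => //=; last lia.
  by split => //; apply: maxsuf_init; lia.
have crit := crit_cut_maxn mx mx1.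
have [cL _] := mx.
case: ltnP => hc.
  rewrite (maxn_idPr (ltnW hc)) in crit.
  split => //; first by bound_upd.
  rewrite /phase_inv /=; case: hz => -> -> ->; split => //=; try lia; by split => //; lia.
rewrite (maxn_idPl hc) in crit.
split => //; first by bound_upd.
rewrite /phase_inv /=; case: hz => -> -> ->; split => //=; try lia; by split => //; lia.
Qed.

Lemma set_unique_inv s E : E rX = X -> (forall v, E v <= 8 * N) ->
  E rBe <= 6 * m -> quiet E -> E rR = X + 1 ->
  unique_reading L Y Tt X (E rPv + 2 * m) -> E rPv < 2 * m ->
  s <= 12 * m + 3 ->
  job_inv z.-1 s.+1 i (upd (upd (upd E rA1 (E rPv + (m + m))) rL (X + L)) rPh 6).
Proof.
move=> hX hb hbe hq hR un pv2 bs; split => //; first by bound_upd.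
rewrite /phase_inv /=; split => //=; [|lia|by move=> u; lia|lia].
by left; split; [|lia|move: un; rewrite mul2n addnn].
Qed.

Lemma step_search_inv s E : job_inv z s i E -> E rPh = 2 ->
  job_inv z.-1 s.+1 i (exec P T' step_search E).
Proof.
move=> [hX hb hbe hph] h2; rewrite /phase_inv h2 in hph.
have [inv [hs p3] hR hq bs] := hph; have [xL crit e1 e2 jm] := inv.
rewrite /step_search /= !denE !condE hX.
have jL : E rJ <= L by lia.
case: ifP => hg; last first.
  have [g0 pm] : E rG = 0 /\ m <= E rP by lia.
  rewrite g0 in bs hs.
  split => //; first by bound_upd.
  rewrite /phase_inv /=; split => //=; [lia|lia|].
  left; split => //; exact: (no_occ_all hB1 hB0 defL Yper pm hs).
have gP : 0 < E rG -> [/\ E rG <= 2, E rPv < 2 * m & E rPv < E rP].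
  by move=> g0; have [] := searched_le hB1 hB0 defL Yper hs g0.
have gL : E rG * L <= 2 * L.
  rewrite leq_mul2r; apply/orP; right; case: (posnP (E rG)) => [-> //|/gP[] //].
case: ifP => hj.
  pose x := E rC; pose p := E rP; pose j := E rJ.
  have -> : (Y (p + x + j) != nth 0 T' (X + (x + j))) && (j < L - x) =
            (x + j < L) && (Y (p + x + j) != c (x + j)).
    rewrite andbC; have -> : (j < L - x) = (x + j < L) by lia.
    by case: ltnP => // h; rewrite text_at //; lia.
  have -> : (Y (p + x - (j + 1)) != nth 0 T' (X + (x - (j + 1)))) && (j < x) =
            (j < x) && (Y (p + x - 1 - j) != c (x - 1 - j)).
    rewrite andbC; case: ltnP => // h; rewrite text_at; last by rewrite /x; lia.
    by rewrite /c -!subnDA [1 + j]addnC.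
  have jm' : j < maxn x (L - x) by rewrite /j /x; lia.
  case: ifP => bad.
    have nocc : no_occ L Y Tt X p (p + j.+1).
      apply: (search_shift hB1 hB0 defL inv) => //.
      by case/orP: bad => /andP[h /eqP h']; [left|right].
    have hs' : searched m L Y Tt X (E rG) (E rPv) (p + (j + 1)).
      rewrite addn1; move: hs gP; rewrite -/p; case: (E rG) => [|[|[|g]]] //=.
      - by move=> hs _; apply: (no_occ_cat hB1 hB0 defL) hs nocc.
      - by move=> [k1 k2 k3 k4] _; split => //; [lia|exact: (no_occ_cat hB1 hB0 defL k4 nocc)].
      - move=> [pv0 [k1 k2 k3 k4 [k5 k6 k7 k8]]] _; exists pv0; split => //.
        by split => //; [lia|exact: (no_occ_cat hB1 hB0 defL k8 nocc)].
    have p3' : p + (j + 1) <= 3 * m.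
      case: (posnP (E rG)) => g0; first by move: hg; rewrite g0 /p /x /j in jm' *; lia.
      have [_ _ pv2 _ [ple _]] := searched_le hB1 hB0 defL Yper hs' g0; lia.
    split => //; first by rewrite /p /j in p3'; bound_upd.
    rewrite /phase_inv /= h2.
    by split; [exact: (search_restart _ inv)| | | |lia].
  split => //; first by bound_upd.
  rewrite /phase_inv /= h2; split => //=; last by lia.
  rewrite addn1; apply: search_next => //.
    by move=> h; apply/eqP; move: bad; rewrite h /= => /norP[/negPn].
  by move=> h; apply/eqP; move: bad; rewrite h /= => /norP[_ /negPn].
have op : occ (E rP).
  apply: (search_found hB1 hB0 defL (x := E rC)).
  by have <- : E rJ = maxn (E rC) (L - E rC) by lia.
case: eqP => g0.
  rewrite g0 in hs hg.
  split => //; first by bound_upd.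
  rewrite /phase_inv /= h2; split; [exact: (search_restart _ inv)| |by []|by []|lia].
  split; last lia.
  by split => //; try lia; move=> u; lia.
have g0' : 0 < E rG by lia.
have [g2 pv2 pvp] := gP g0'.
case: ltnP => hgap.
  case: eqP => g2'.
    apply: set_unique_inv => //; last lia.
    by rewrite g2' in hs; apply: (searched_unique hB1 hB0 defL Yper hs op) => //; lia.
  have g1 : E rG = 1 by lia.
  rewrite g1 in hs bs; have [k1 k2 k3 k4] := hs.
  have ple := no_occ_le hB1 hB0 defL Yper k2 k4.
  split => //; first by bound_upd.
  rewrite /phase_inv /= h2; split; [exact: (search_restart _ inv)| |by []|by []|lia].
  split; last lia.
  exists (E rPv); split => //; first lia.
  by split => //; [lia|move=> u; lia].
have [gp _] := searched_gap hB1 hB0 defL Yper hs g0 op ltac:(lia).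
split => //; first by bound_upd.
rewrite /phase_inv /=; split => //=; [split; [lia|]|lia].
by move=> u; lia.
Qed.

Lemma step_right_inv s E : job_inv z s i E -> E rPh = 3 ->
  job_inv z.-1 s.+1 i (exec P T' step_right E).
Proof.
move=> [hX hb hbe hph] h2; rewrite /phase_inv h2 in hph.
have [[gp pv2] [ha hY] hR hq bs] := hph.
have [q0 q2 _ _ _] := gp.
rewrite /step_right /= !denE !condE hX.
case: ltnP => am; last first.
  apply: set_unique_inv => //; last lia.
  by apply: (gap_all_unique hB1 hB0 defL Yper gp) => u hu; apply: hY; lia.
case: eqP => e.
  split => //; first by bound_upd.
  rewrite /phase_inv /= h2; split => //=; last lia.
  split; first lia.
  by move=> u hu; case: (eqVneq u (E rA)) => [-> //|ne]; apply: hY; lia.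
have ri := right_stop hB1 hB0 defL Yper (t := E rA) gp pv2 ltac:(lia) hY e.
rewrite [2 * m]mul2n -addnn in ri.
split => //; [by bound_upd|by rewrite /=; lia|].
rewrite /phase_inv /=; split => //=; [lia|by move=> u; lia|lia].
Qed.

Lemma step_left_inv s E : job_inv z s i E -> E rPh = 4 ->
  job_inv z.-1 s.+1 i (exec P T' step_left E).
Proof.
move=> [hX hb hbe hph] h2; rewrite /phase_inv h2 in hph.
have [ri [ha hbe'] hY hq bs] := hph.
have [gp A04 _ hbe2 _] := ri.
rewrite /step_left /= !denE !condE hX.
case: eqP => e.
  split => //; first by bound_upd.
  have lb := left_bound hB1 hB0 defL Yper ri (t := E rA - 1) ltac:(lia) ltac:(lia) e.
  rewrite /phase_inv /= h2; split => //=; [lia| |lia].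
  by move=> u hu; case: (eqVneq u (E rA - 1)) => [-> //|ne]; apply: hY; lia.
have run := left_stop hB1 hB0 defL ri hbe' ha hY e.
split => //; first by bound_upd.
by rewrite /phase_inv /=; split => //=; [lia|move=> u; lia|lia].
Qed.

Lemma step_text_left_inv s E : job_inv z s i E -> E rPh = 5 ->
  job_inv z.-1 s.+1 i (exec P T' step_text_left E).
Proof.
move=> [hX hb hbe hph] h2; rewrite /phase_inv h2 in hph.
have [run hr hT hq bs] := hph.
have [[q0 q2 _ _ _] A04 _ [_ alA _ _] _] := run.
rewrite /step_text_left /= !denE !condE hX.
rewrite !text_at; [|lia|lia].
case: ifP => [/and3P[r0 rX /eqP e]|stop].
  split => //; first by bound_upd.
  rewrite /phase_inv /= h2; split => //=; [lia| |lia].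
  by move=> u hu; case: (eqVneq u (E rR - 1)) => [-> //|ne]; apply: hT; lia.
split => //; first by bound_upd.
rewrite /phase_inv /=; split => //=; [|lia|by move=> u; lia|lia].
right; split => //; move/negbT: stop; rewrite !negb_and.
by case/or3P => [?|?|/eqP ?]; [left; lia|right; left; lia|right; right].
Qed.

Lemma step_align_left_inv s E : job_inv z s i E -> E rPh = 6 ->
  job_inv z.-1 s.+1 i (exec P T' step_align_left E).
Proof.
move=> [hX hb hbe hph] h2; rewrite /phase_inv h2 in hph.
have [rd hl hA hq bs] := hph.
have A1b := ready_bounds hB1 hB0 defL rd.
rewrite /step_align_left /= !denE !condE hX.
rewrite !text_at; last lia.
case: ifP => [/and3P[l0 lX /eqP e]|stop].
  split => //; first by bound_upd.
  rewrite /phase_inv /= h2; split => //=; [lia| |lia].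
  move=> u hu; case: (eqVneq u (E rL - 1)) => [->|ne]; last by apply: hA; lia.
  by rewrite e; congr Y; lia.
split => //; first by bound_upd.
rewrite /phase_inv /=; split => //=; [lia|lia|right; split => //; first lia].
  move/negbT: stop; rewrite !negb_and.
  by case/or3P => [?|?|/eqP ?]; [left; lia|right; left; lia|right; right].
by case: hq => -> -> ->; apply: (@engine_init m B L Y Tt X hB1 hB0 defL).
Qed.

Lemma step_engine_inv s E : job_inv z s i E -> 6 < E rPh ->
  job_inv z.-1 s.+1 i (exec P T' step_engine E).
Proof.
move=> [hX hb hbe hph] h2.
have h7 : E rPh = 7.
  by move: hph h2; rewrite /phase_inv; case: (E rPh) => [|[|[|[|[|[|[|[|?]]]]]]]].
rewrite /phase_inv h7 in hph; have [hH hz hC] := hph.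
have hT' : size T' = i by rewrite /T' size_takel.
rewrite /step_engine /= hT' !denE !condE.
case: ltnP => hi; last first.
  split => //; rewrite /phase_inv h7; split => //; left; lia.
(* Every branch changes at most these five registers, so each reduces to a case of [engine_step]. *)
have key (E' : nat -> nat) (d1 ra A2 d2 : nat) :
    (forall v, E' v = upd (upd (upd (upd (upd E rD1 d1) rRa ra) rA2 A2) rD2 d2) rH (E rH + 1) v) ->
    d1 <= 1 \/ d1 = E rD1 -> (E rD1 <> 0 -> d1 <> 0) ->
    ra <= 1 \/ ra = E rRa -> A2 <= 8 * N -> d2 <= 1 \/ d2 = E rD2 ->
    (engine L Y Tt X (E rQ) (E rA1) (E rBe) (E rH) (E rD1) (E rRa) (E rA2) (E rD2) ->
     engine L Y Tt X (E rQ) (E rA1) (E rBe) (E rH + 1) d1 ra A2 d2) ->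
    job_inv z.-1 s.+1 i E'.
  move=> EE v1 v1' v2 v3 v4 eng.
  have b1 := hb rD1; have b2 := hb rRa; have b3 := hb rD2.
  split; rewrite ?EE //.
    by move=> v; rewrite EE; move: v; bound_upd.
  rewrite /phase_inv !EE /= h7; split; [lia|case: hz; [left|right]; lia|].
  case: hC => [[c1 c2 c3]|[c1 c2 c3 c4 c5]]; [left; split => //; exact: v1'|].
  by right; split => //; apply: eng.
have es := @engine_step m B L Y Tt X hB1 hB0 defL (E rQ) (E rA1) (E rBe) (E rH)
  (E rD1) (E rRa) (E rA2) (E rD2) ltac:(lia).
have t1 : nth 0 T' (E rH) = Tt (E rH) by rewrite text_at.
have t2 : nth 0 T' (E rH - E rQ) = Tt (E rH - E rQ) by rewrite text_at //; lia.
have A2b : E rBe + X - E rH <= 8 * N by lia.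
have hA2 := hb rA2.
case e1 : (Tt (E rH) == Y (E rA1 + E rH - X)) es => es;
  case r0 : (E rRa == 0) es => es;
  [case e2 : (Tt (E rH) == Tt (E rH - E rQ)) es => es| |
   case e2 : (Tt (E rH) == Tt (E rH - E rQ)) es => es|];
  rewrite /= ?r0 /= in es;
  rewrite t1 hX e1 /= ?r0 ?t1 ?t2 ?e2 /= ?r0 /= ?t1 ?hX.
- apply: (key _ (E rD1) (E rRa) (E rA2) (E rD2)) => //; try by right.
  by upd_ext.
all: try match goal with
  |- job_inv _ _ _ (upd (if ?b then _ else _) _ _) => case: b es => es /= end.
all: match type of es with _ -> engine _ _ _ _ _ _ _ _ ?d1 ?ra ?A2 ?d2 =>
       apply: (key _ d1 ra A2 d2) => //; try (by right); try (by left);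
       by upd_ext end.
Qed.

Lemma micro_inv s E : job_inv z s i E -> job_inv z.-1 s.+1 i (exec P T' micro E).
Proof.
move=> h.
have -> : exec P T' micro E =
  if ((E rPh < 2 : bool) : nat) != 0 then exec P T' step_maxsuf E else
  if ((E rPh == 2 : bool) : nat) != 0 then exec P T' step_search E else
  if ((E rPh == 3 : bool) : nat) != 0 then exec P T' step_right E else
  if ((E rPh == 4 : bool) : nat) != 0 then exec P T' step_left E else
  if ((E rPh == 5 : bool) : nat) != 0 then exec P T' step_text_left E else
  if ((E rPh == 6 : bool) : nat) != 0 then exec P T' step_align_left E else
  exec P T' step_engine E by [].
rewrite !condE.
case: ifP => h2; first exact: step_maxsuf_inv.
case: eqP => [h3|n2]; first exact: step_search_inv.
case: eqP => [h3|n3]; first exact: step_right_inv.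
case: eqP => [h3|n4]; first exact: step_left_inv.
case: eqP => [h3|n5]; first exact: step_text_left_inv.
case: eqP => [h3|n6]; first exact: step_align_left_inv.
by apply: step_engine_inv => //; lia.
Qed.

Lemma phase_steps s E : job_inv z s i E -> E rPh < 7 -> s <= 15 * m + 8.
Proof.
move=> [hX hb hbe hph]; move: hph; rewrite /phase_inv.
case: (E rPh) => [|[|[|[|[|[|[|//]]]]]]] + _.
- by move=> [[]]; lia.
- by move=> [[[]]]; lia.
- move=> [[xL _ _ _ h1] [hs h2] _ _ h3].
  have gL : E rG * L <= 2 * L.
    rewrite leq_mul2r; apply/orP; right; case: (posnP (E rG)) => [-> //|g0].
    by have [] := searched_le hB1 hB0 defL Yper hs g0.
  lia.
- by move=> [_ []]; lia.
- by move=> [[_ _ _ h1 _] [h2 h3] _ _]; lia.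
- by move=> [_ h1 _ _]; lia.
- by move=> [_ h1 _ _]; lia.
Qed.

End Job.

(** * Scheduling of the jobs *)

Fixpoint silent s :=
  match s with
  | Skip | Asg _ _ => true
  | Seq a b | If _ a b => silent a && silent b
  | Out _ => false
  end.

Lemma outs_silent P T s E : silent s -> outs P T s E = [::].
Proof.
elim: s E => //= [a IHa b IHb|e a IHa b IHb] E /andP[ha hb]; first by rewrite IHa // IHb.
by case: ifP => _; [apply: IHa|apply: IHb].
Qed.

Lemma silent_micros : silent micros.
Proof. by rewrite /micros; elim: speed => //= n ->. Qed.

Lemma silent_reset : silent reset.
Proof. by []. Qed.

Lemma exec_micros P T E : exec P T micros E = iter speed (exec P T micro) E.
Proof.
rewrite /micros; elim: speed E => // n IHn E.
by rewrite [RHS]iterSr -IHn.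
Qed.

Lemma modnS_cases x d : 0 < d ->
  x.+1 %% d = 0 \/ x.+1 %% d = (x %% d).+1.
Proof.
move=> d0; have h : x %% d < d by rewrite ltn_pmod.
rewrite -addn1 -modnDml addn1; case: (ltnP (x %% d).+1 d) => h'.
  by right; rewrite modn_small.
by left; rewrite (_ : (x %% d).+1 = d) ?modnn //; lia.
Qed.

(** This is the shape of [slot] with abstract components, so that computing it does not unfold the
    256 copies of [micro]. *)
Lemma exec_guarded P T c a r s b1 b2 d E : (forall E', exec P T d E' = E') ->
  exec P T (If c Skip (Seq (If a r Skip) (Seq s (If b1 (If b2 Skip d) Skip)))) E =
  if den P T E c != 0 then E
  else exec P T s (if den P T E a != 0 then exec P T r E else E).
Proof.
move=> hd /=; case: ifP => // _; move: (exec P T s _) => E1.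
by case: ifP => // _; case: ifP.
Qed.

Lemma outs_guarded P T c a r s b1 b2 d E : silent r -> silent s ->
  outs P T (If c Skip (Seq (If a r Skip) (Seq s (If b1 (If b2 Skip d) Skip)))) E =
  if den P T E c != 0 then [::]
  else let E1 := exec P T s (if den P T E a != 0 then exec P T r E else E) in
    if den P T E1 b1 != 0 then
      if den P T E1 b2 != 0 then [::] else outs P T d E1
    else [::].
Proof.
move=> hr hs /=; case: ifP => // _.
rewrite (_ : (if _ then outs P T r E else [::]) = [::]) ?(outs_silent _ _ _ hs) //.
by case: ifP => // _; apply: outs_silent.
Qed.

Lemma exec_decide P T E : exec P T decide E = E.
Proof. by rewrite /decide /=; do !case: ifP => _. Qed.

Section Slot.

Variables (P T : seq nat) (m B L k : nat).
Let N := m + size T.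
Let Y t := nth 0 P (t %% m).
Let Tt u := nth 0 T u.

Hypotheses (defm : size P = m) (defB : block_size m B) (defL : L = m - 2 * B).
Hypotheses (hB0 : 0 < B) (hB1 : 8 * B <= m) (hB2 : m < 8 * B + 8).
Hypothesis k2 : k < 2.

(* Number of letters that have arrived since the current job of bank [k] started. *)
Definition age i := (i - 1 + (if k is 0 then 0 else B)) %% (B + B) + 1.

Lemma age_bounds i : 0 < age i <= 2 * B.
Proof.
have : (i - 1 + (if k is 0 then 0 else B)) %% (B + B) < B + B by rewrite ltn_pmod; lia.
by rewrite /age; move: (_ %% _); lia.
Qed.

Lemma ageS i : 0 < i -> age i.+1 = 1 \/ age i.+1 = (age i).+1.
Proof.
move=> i0; rewrite /age.
have -> : i.+1 - 1 + (if k is 0 then 0 else B) = (i - 1 + (if k is 0 then 0 else B)).+1.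
  by lia.
have [->| ->] := @modnS_cases (i - 1 + (if k is 0 then 0 else B)) (B + B) ltac:(lia).
  by left.
by right; rewrite addSn.
Qed.

Lemma age1 : age 1 = 1 \/ age 1 = B.+1.
Proof.
rewrite /age subnn add0n; case: k => [|k']; first by left; rewrite mod0n.
by right; rewrite modn_small ?addn1 //; lia.
Qed.

(** The equation determines [X], which is constant during a job as [i] and [age i] advance together;
    it has no solution in [nat] while the slot idles. *)
Definition slot_inv i E := (forall v, E v <= 8 * N) /\
  forall X, 0 < i -> X + m + age i = i + 2 * B ->
    job_inv P T m B L N X 0 (speed * age i) i E.

Lemma job_inv_next X s i E : job_inv P T m B L N X 0 s i E ->
  job_inv P T m B L N X 1 s i.+1 E.
Proof.
move=> [h1 h2 h3 h4]; split => //; move: h4; rewrite /phase_inv.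
case: (E rPh) => [|[|[|[|[|[|[|[|//]]]]]]]] //.
by move=> [c1 c2 c3]; split => //; lia.
Qed.

Lemma reset_inv X i E : i = X + L + 1 -> i <= size T -> (forall v, E v <= 8 * N) ->
  job_inv P T m B L N X 1 0 i (exec P (take i T) reset E).
Proof.
move=> iX iT hE.
have sT : size (take i T) = i by rewrite size_takel.
rewrite /reset /= sT defm -defB.
have -> : i + (B + B) - (m + 1) = X by lia.
split => //.
- by bound_upd.
- rewrite /phase_inv /=; split => //.
  by apply: maxsuf_init; lia.
Qed.

Lemma micros_inv X i E s : X + L <= i -> i <= size T ->
  job_inv P T m B L N X 1 s i E ->
  job_inv P T m B L N X 0 (s + speed) i (exec P (take i T) micros E).
Proof.
move=> h1 h2 h3; rewrite exec_micros.
(* One new letter means a lag of 1; every step lowers the lag by one, down to 0. *)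
have -> : 0 = 1 - speed by [].
elim: speed => [|n IHn]; first by rewrite addn0 subn0.
rewrite iterS addnS subnS; exact: (micro_inv defm defB defL hB0 hB1 (leqnn N) h1 h2 IHn).
Qed.

Lemma den_age i E : i <= size T -> den P (take i T) E (ageE k) = age i.
Proof.
move=> iT; rewrite /ageE /= size_takel // /age.
by case: (k) => [|k'] /=; rewrite defm -defB.
Qed.

Lemma job_answer X i E n : X + m + n = i + 2 * B -> B < n <= 2 * B -> m <= i ->
  i <= size T -> job_inv P T m B L N X 0 (speed * n) i E ->
  answer m X (E rQ) (E rA0) (E rAl) (E rBe) (E rR) (E rL) (E rD1) (E rRa) (E rA2)
    (E rD2) (i - m) <-> cyclic_window m Y Tt (i - m).
Proof.
move=> eX hn mi iT J.
have speedE : speed * n = 256 * n by [].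
have yi : X + L <= i by lia.
have ph7 : 7 <= E rPh.
  rewrite leqNgt; apply/negP => h.
  by have := phase_steps defm defL hB0 hB1 (leqnn N) yi iT J h; lia.
have [hX hb hbe hph] := J.
have h7 : E rPh = 7.
  by move: hph ph7; rewrite /phase_inv; case: (E rPh) => [|[|[|[|[|[|[|[|?]]]]]]]].
rewrite /phase_inv h7 in hph; have [hH hz hC] := hph.
have hi : E rH = i - m + m by lia.
case: hC => [[c1 c2 c3]|[c1 c2 c3 c4 c5]].
  have -> : answer m X (E rQ) (E rA0) (E rAl) (E rBe) (E rR) (E rL) (E rD1) (E rRa)
      (E rA2) (E rD2) (i - m) = false.
    rewrite /answer c1; have -> : i - m < X + 1 by lia.
    by case: eqP => // _; rewrite andbF.
  split=> // [[a Ha]]; exfalso; apply: (c3 (a + (X - (i - m)))).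
  by apply: (cyclic_window_occurs hB1 _ defL _ _ Ha); lia.
rewrite hi in c5.
by apply: (answer_correct hB1 hB0 defL (@Yper P m) c1 c2 c3 c4 c5); lia.
Qed.

Lemma outs_decide X i E : m <= i <= size T -> E rX = X ->
  outs P (take i T) decide E =
  if answer m X (E rQ) (E rA0) (E rAl) (E rBe) (E rR) (E rL) (E rD1) (E rRa) (E rA2)
    (E rD2) (i - m) then [:: i - m] else [::].
Proof.
move=> /andP[mi iT] hX.
rewrite /decide /= !size_takel // defm hX !condE /answer.
case: ifP => // _; first by rewrite addn1 ltnS.
by case: ifP => _; rewrite ?addn1 ?ltnS //; case: leqP.
Qed.

Local Opaque micros speed reset decide ageE.

Lemma slot_step i E : i < size T -> slot_inv i E ->
  slot_inv i.+1 (exec P (take i.+1 T) (slot k) E) /\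
  exists b : bool, 
    outs P (take i.+1 T) (slot k) E = (if b then [:: i.+1 - m] else [::]) /\
    if B < age i.+1 then b <-> m <= i.+1 /\ cyclic_window m Y Tt (i.+1 - m)
    else b = false.
Proof.
move=> iT [hE hJ]; set T' := take i.+1 T.
have sT : size T' = i.+1 by rewrite size_takel.
have hn := age_bounds i.+1.
have da E' : den P T' E' (ageE k) = age i.+1 by apply: den_age.
have execE : exec P T' (slot k) E =
    if i.+1 + (B + B) < m + age i.+1 then E else
    exec P T' micros (if age i.+1 == 1 then exec P T' reset E else E).
  transitivity (if den P T' E (Bin Less (Bin Plus TLen (Bin Plus blockE blockE))
                                 (Bin Plus PLen (ageE k))) != 0 then E else
    exec P T' micros (if den P T' E (Bin Same (ageE k) (Cst 1)) != 0
                      then exec P T' reset E else E)).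
    by apply: exec_guarded => E'; apply: exec_decide.
  by rewrite /= !da sT defm -defB !condE.
have outE : outs P T' (slot k) E =
    if i.+1 + (B + B) < m + age i.+1 then [::] else
    if (B < age i.+1) && (m <= i.+1)
    then outs P T' decide (exec P T' (slot k) E) else [::].
  transitivity (if den P T' E (Bin Less (Bin Plus TLen (Bin Plus blockE blockE))
                                 (Bin Plus PLen (ageE k))) != 0 then [::] else
    let E1 := exec P T' micros (if den P T' E (Bin Same (ageE k) (Cst 1)) != 0
                      then exec P T' reset E else E) in
    if den P T' E1 (Bin Less blockE (ageE k)) != 0 then
      if den P T' E1 (Bin Less TLen PLen) != 0 then [::] else outs P T' decide E1
    else [::]).
    by apply: outs_guarded; [exact: silent_reset | exact: silent_micros].
  rewrite execE /= !da sT defm -defB !condE; case: ifP => // _.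
  by case: (ltnP B _) => //= _; case: (ltnP i.+1 m).
case: (ltnP (i.+1 + (B + B)) (m + age i.+1)) => act.
  rewrite execE outE act; split.
    by split => // X _ h; lia.
  exists false; split => //; case: ifP => // _; split => // [[h _]]; lia.
have [X eX] : exists X, X + m + age i.+1 = i.+1 + 2 * B.
  by exists (i.+1 + 2 * B - m - age i.+1); lia.
have J1 : job_inv P T m B L N X 1 (speed * (age i.+1 - 1)) i.+1
    (if age i.+1 == 1 then exec P T' reset E else E).
  case: eqP => a1.
    by rewrite a1 subnn muln0; apply: reset_inv => //; lia.
  (* An active job has begun with a reset: at the first letter, a slot of age [B + 1] is still
     idle. *)
  case: (posnP i) => i0; first by move: act a1; rewrite i0; have [->|->] := age1; lia.
  have [//|aS] := ageS i0.
  rewrite aS subn1 /=; apply: job_inv_next; apply: hJ => //; lia.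
have J2 := micros_inv (X := X) (i := i.+1) ltac:(lia) iT J1.
have nact : (i.+1 + (B + B) < m + age i.+1) = false by rewrite ltnNge act.
rewrite nact in execE; rewrite nact in outE.
rewrite -/T' -execE in J2.
have sE : speed * (age i.+1 - 1) + speed = speed * age i.+1.
  by rewrite -mulnSr; congr muln; lia.
rewrite sE in J2; have [hX hb _ _] := J2.
split.
  by split => // X' _ h; have -> : X' = X by lia.
rewrite outE; case: (ltnP B (age i.+1)) => hB /=; last by exists false.
case: (leqP m i.+1) => mi; last by exists false; split => //; split => // [[]]; lia.
rewrite (outs_decide (X := X)) //; last by rewrite mi.
eexists; split; first by reflexivity.
have Q := job_answer eX ltac:(lia) mi iT J2.
by split => [/Q|[_ /Q]].
Qed.

End Slot.

(** * Short patterns and the theorem *)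

Definition cyc_at (P : seq nat) t := nth 0 P (t %% size P).

Definition window_spec (P T : seq nat) i :=
  size P <= i /\ cyclic_window (size P) (cyc_at P) (nth 0 T) (i - size P).

Lemma nth_rot (P : seq nat) D t : D <= size P -> t < size P ->
  nth 0 (rot D P) t = cyc_at P (D + t).
Proof.
move=> hD ht; rewrite /rot nth_cat size_drop /cyc_at.
case: ltnP => h; first by rewrite nth_drop modn_small //; lia.
rewrite nth_take; last lia.
have -> : D + t = size P + (D + t - size P) by lia.
rewrite modnDl modn_small; last lia.
by congr nth; lia.
Qed.

Lemma is_rotationP P W : 0 < size P -> size W = size P ->
  is_rotation P W <-> exists a, forall t, t < size P -> nth 0 W t = cyc_at P (a + t).
Proof.
move=> P0 sW; split.
  move=> /hasP[D]; rewrite mem_iota => hD /eqP ->; exists D => t ht.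
  by apply: nth_rot => //; lia.
move=> [a Ha]; set r := a %% size P; have hr : r < size P by rewrite ltn_pmod.
(* Rotations are indexed by [1..m], so the residue 0 is represented by [m]. *)
pose D := if r == 0 then size P else r.
have hD : 0 < D <= size P by rewrite /D; case: eqP; lia.
apply/hasP; exists D; first by rewrite mem_iota; lia.
apply/eqP/(@eq_from_nth _ 0); rewrite ?size_rot // => t; rewrite sW => ht.
rewrite Ha // nth_rot; [|lia|lia].
rewrite /cyc_at; congr nth; rewrite -modnDml -/r /D.
by case: eqP => [->|_] //; rewrite add0n modnDl.
Qed.

Lemma circ_occ_endingE P T i : 0 < size P -> i <= size T ->
  circ_occ_ending P T i =
  if (size P <= i) && circ_occ P T (i - size P) then [:: i - size P] else [::].
Proof.
move=> P0 iT; rewrite /circ_occ_ending; set m := size P in P0 *.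
have no lo n : (forall s, lo <= s < lo + n -> s + m != i) ->
    [seq s <- iota lo n | (s + m == i) && circ_occ P T s] = [::].
  move=> h; rewrite (@eq_in_filter _ _ pred0) ?filter_pred0 // => s.
  by rewrite mem_iota => /h/negbTE ->.
case: leqP => mi /=; last by apply: no => s; lia.
have -> : iota 0 i = iota 0 (i - m) ++ iota (i - m) 1 ++ iota (i - m).+1 (m - 1).
  have {1}-> : i = (i - m) + (1 + (m - 1)) by lia.
  by rewrite iotaD iotaD add0n addn1.
rewrite !filter_cat no ?cat0s; last by move=> s; lia.
rewrite [X in _ ++ X]no ?cats0; last by move=> s; lia.
by rewrite /= subnK // eqxx.
Qed.

Lemma circ_occP P T i : 0 < size P -> size P <= i <= size T ->
  circ_occ P T (i - size P) <->
  cyclic_window (size P) (cyc_at P) (nth 0 T) (i - size P).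
Proof.
move=> P0 /andP[mi iT]; rewrite /circ_occ subnK // iT /=.
have sW : size (take (size P) (drop (i - size P) T)) = size P.
  by rewrite size_takel // size_drop; lia.
have nW t : t < size P ->
    nth 0 (take (size P) (drop (i - size P) T)) t = nth 0 T (i - size P + t).
  by move=> ht; rewrite nth_take // nth_drop.
split; first by move=> /(is_rotationP P0 sW)[a Ha]; exists a => t ht; rewrite -Ha // nW.
by move=> [a Ha]; apply/(is_rotationP P0 sW); exists a => t ht; rewrite nW // Ha.
Qed.

Lemma circ_occ_ending_bool P T i (b : bool) : 0 < size P -> i <= size T ->
  (b <-> window_spec P T i) ->
  circ_occ_ending P T i = if b then [:: i - size P] else [::].
Proof.
move=> P0 iT hb; rewrite circ_occ_endingE //; congr (if _ then _ else _).
apply/idP/idP => [/andP[mi h]|/hb[mi h]].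
  by apply/hb; split => //; apply/circ_occP => //; rewrite mi.
by rewrite mi; apply/circ_occP => //; rewrite mi.
Qed.

Lemma den_allE P T E f n :
  (den P T E (allE f n) != 0) = all (fun j => den P T E (f j) != 0) (iota 0 n).
Proof.
rewrite /allE; elim: (iota 0 n) => //= j s <-.
by move: (den P T E _) (den P T E _) => [|x] [|y].
Qed.

Lemma den_anyE P T E f n :
  (den P T E (anyE f n) != 0) = has (fun j => den P T E (f j) != 0) (iota 0 n).
Proof. by rewrite /anyE; elim: (iota 0 n) => //= j s <-; rewrite addn_eq0 negb_and orbC. Qed.

Lemma exec_guarded_out P T c1 c2 e E :
  exec P T (If c1 Skip (If c2 (Out e) Skip)) E = E.
Proof. by rewrite /=; case: ifP => // _; case: ifP. Qed.

Lemma exec_brute P T E : exec P T brute E = E.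
Proof. exact: exec_guarded_out. Qed.

Lemma outs_guarded_out P T c1 c2 e E :
  outs P T (If c1 Skip (If c2 (Out e) Skip)) E =
  if den P T E c1 != 0 then [::] else if den P T E c2 != 0 then [:: den P T E e] else [::].
Proof. by []. Qed.

Lemma bruteE_correct P T i E : 0 < size P < 8 -> size P <= i <= size T ->
  den P (take i T) E bruteE != 0 <->
  cyclic_window (size P) (cyc_at P) (nth 0 T) (i - size P).
Proof.
move=> /andP[P0 P8] /andP[mi iT]; rewrite /bruteE den_anyE.
have cond D j : j < size P ->
   (den P (take i T) E (Bin Less (Bin Less (Cst j) PLen)
      (Bin Plus (Bin Same (cycE (Bin Plus (Cst D) (Cst j))) (TAt (Bin Plus startE (Cst j))))
        (Cst 1))) != 0) = (cyc_at P (D + j) == nth 0 T (i - size P + j)).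
  move=> hj; rewrite /= size_takel // nth_take; last lia.
  by rewrite hj nz_bool /cyc_at; case: (nth _ _ _ == _).
split.
  move=> /hasP[D _]; rewrite den_allE => /allP h; exists D => t ht.
  have := h t; rewrite mem_iota cond // => /(_ ltac:(lia)) /eqP ->.
  by [].
move=> [a Ha]; apply/hasP; exists (a %% size P).
  by rewrite mem_iota /=; apply: leq_trans (ltn_pmod _ P0) _; lia.
rewrite den_allE; apply/allP => j; rewrite mem_iota => hj.
case: (ltnP j (size P)) => hjP; last by rewrite /= (_ : (j < size P) = false) ?nz_bool ?addn1 //; lia.
by rewrite cond // Ha // /cyc_at modnDml eqxx.
Qed.

Local Opaque bruteE.

Lemma outs_brute P T i E : 0 < size P < 8 -> i <= size T ->
  outs P (take i T) brute E = circ_occ_ending P T i.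
Proof.
move=> hP iT.
rewrite /brute outs_guarded_out [den _ _ _ (Bin _ _ _)]/= [den _ _ _ startE]/=.
rewrite size_takel // nz_bool.
rewrite (@circ_occ_ending_bool _ _ _ ((size P <= i) && (den P (take i T) E bruteE != 0))) //.
- by case: leqP.
- lia.
case: (leqP (size P) i) => mi /=; last by split => // [[]]; lia.
split; first by move=> /bruteE_correct h; split => //; apply: h => //; rewrite mi.
by move=> [_ h]; apply/bruteE_correct => //; rewrite mi.
Qed.

Local Opaque brute slot.

(** A shift by half the cycle exchanges its two halves; hence each window is answered by one bank
    and reported at most once. *)
Lemma ages_complementary B i : 0 < B -> (B < age B 0 i) = ~~ (B < age B 1 i).
Proof.
move=> B0; rewrite /age addn0 -(modnDml _ B).
have h : (i - 1) %% (B + B) < B + B by apply: ltn_pmod; lia.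
move: (_ %% (B + B)) h => r h.
case: (ltnP r B) => rB.
  by rewrite modn_small; [apply/idP/idP|]; lia.
have -> : r + B = B + B + (r - B) by lia.
by rewrite modnDl modn_small; [apply/idP/idP|]; lia.
Qed.

Lemma exec_bank P T k E : 8 <= size P -> exec P T (bank k) E = exec P T (slot k) E.
Proof.
move=> h.
have -> : exec P T (bank k) E = if ((size P < 8 : bool) : nat) != 0
  then exec P T (if k is 0 then brute else Skip) E else exec P T (slot k) E by [].
by rewrite nz_bool ltnNge h.
Qed.

Lemma exec_bank_small P T k E : size P < 8 -> exec P T (bank k) E = E.
Proof.
move=> h.
have -> : exec P T (bank k) E = if ((size P < 8 : bool) : nat) != 0
  then exec P T (if k is 0 then brute else Skip) E else exec P T (slot k) E by [].
by rewrite nz_bool h; case: k => // ; apply: exec_brute.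
Qed.

Lemma env_bank_small P T k i v : size P < 8 -> env P T (bank k) i v = 0.
Proof.
move=> hP; elim: i v => // i IHi v.
have -> : env P T (bank k) i.+1 = exec P (take i.+1 T) (bank k) (env P T (bank k) i) by [].
by rewrite exec_bank_small.
Qed.

Lemma outs_bank_small P T k E : size P < 8 ->
  outs P T (bank k) E = if k is 0 then outs P T brute E else [::].
Proof.
move=> h.
have -> : outs P T (bank k) E = if ((size P < 8 : bool) : nat) != 0
  then outs P T (if k is 0 then brute else Skip) E else outs P T (slot k) E by [].
by rewrite nz_bool h; case: k.
Qed.

Lemma outs_bank P T k E : 8 <= size P -> outs P T (bank k) E = outs P T (slot k) E.
Proof.
move=> h.
have -> : outs P T (bank k) E = if ((size P < 8 : bool) : nat) != 0
  then outs P T (if k is 0 then brute else Skip) E else outs P T (slot k) E by [].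
by rewrite nz_bool ltnNge h.
Qed.

Section Correctness.

Variables (P T : seq nat).
Hypothesis P8 : 8 <= size P.
Let m := size P.
Let B := m %/ 8.
Let L := m - 2 * B.

Lemma slot_inv_env k i : k < 2 -> i <= size T ->
  slot_inv P T m B L k i (env P T (bank k) i).
Proof.
move=> k2; have dB : block_size m B by [].
have [b1 b2 b3] := block_sizeP dB P8.
elim: i => [|i IHi] hi; first by split => // X; lia.
rewrite (_ : env _ _ _ i.+1 = exec P (take i.+1 T) (bank k) (env P T (bank k) i)) //.
rewrite exec_bank //.
by have [] := slot_step (erefl m) dB (erefl L) b1 b2 b3 k2 hi (IHi (ltnW hi)).
Qed.

Lemma outs_banks i : i < size T ->
  outs P (take i.+1 T) (bank 0) (env P T (bank 0) i) ++
  outs P (take i.+1 T) (bank 1) (env P T (bank 1) i) = circ_occ_ending P T i.+1.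
Proof.
move=> iT; have dB : block_size m B by [].
have [b1 b2 b3] := block_sizeP dB P8.
rewrite !outs_bank //.
have [_ [x0 [-> h0]]] := slot_step (erefl m) dB (erefl L) b1 b2 b3 (isT : 0 < 2) iT
  (@slot_inv_env 0 i isT (ltnW iT)).
have [_ [x1 [-> h1]]] := slot_step (erefl m) dB (erefl L) b1 b2 b3 (isT : 1 < 2) iT
  (@slot_inv_env 1 i isT (ltnW iT)).
rewrite ages_complementary // in h0.
case: (B < age B 1 i.+1) h0 h1 => /= h0 h1.
  by rewrite h0 /=; symmetry; apply: circ_occ_ending_bool => //; lia.
by rewrite h1 cats0; symmetry; apply: circ_occ_ending_bool => //; lia.
Qed.

End Correctness.

(** [8 * N] bounds the registers and [N ^ a] the letters. As [N >= 2], the growth factor [g] is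
    below [N ^ g], and the constant 8 is at most [N ^ 3]. *)
Lemma word_size_bound g N a w : 1 < N -> N ^ (g + a + 6) <= 2 ^ w ->
  g * (8 * N + N ^ a) < 2 ^ w.
Proof.
move=> N2 h; apply: leq_trans h.
have h1 : g < N ^ g by apply: ltn_expl.
have h2 : 8 <= N ^ 3 by rewrite -[8]/(2 ^ 3) leq_exp2r.
have h3 : 0 < N ^ a by rewrite expn_gt0; lia.
have h4 : 8 * N + N ^ a <= N ^ (a + 6).
  rewrite expnD; have -> : N ^ 6 = N ^ 3 * N * (N * N) by rewrite !expnS expn0; lia.
  move: (N ^ 3) h2 (N ^ a) h3 => x h2 y h3.
  have hx : 8 * N <= x * N by rewrite leq_mul2r h2 orbT.
  move: (x * N) hx => u hu.
  have hNN : 2 <= N * N by nia.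
  move: (N * N) hNN => v hv.
  have huv : u + 1 <= u * v by nia.
  by apply: leq_trans (leq_mul (leqnn y) huv); nia.
rewrite -addnA expnD; apply: leq_trans (leq_mul h1 h4).
by rewrite ltn_mul2r ltnSn addn_gt0 h3 orbT.
Qed.

Lemma online_prog_nil w S0 S1 T :
  let A := online_prog S0 S1 in
  online_circ_matching w A [::] T (size A) (static_space A).
Proof.
move=> A i _; have [h1 _ h3] := run_nil w S0 S1 T i (erefl [::]).
split; [exact: h1|exact/run_space/online_prog_direct|rewrite h3].
rewrite /circ_occ_ending (@eq_filter _ _ pred0) ?filter_pred0 // => s.
by rewrite /circ_occ /= !andbF.
Qed.

Lemma online_prog_correct w S0 S1 P T V :
  let A := online_prog S0 S1 in
  0 < size P -> size P + size T <= V ->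
  all (fun x => x <= V) P -> all (fun x => x <= V) T ->
  (forall i v, i <= size T -> env P T S0 i v <= V) ->
  (forall i v, i <= size T -> env P T S1 i v <= V) ->
  growth S0 * V < 2 ^ w -> growth S1 * V < 2 ^ w ->
  (forall i, i < size T ->
    outs P (take i.+1 T) S0 (env P T S0 i) ++ outs P (take i.+1 T) S1 (env P T S1 i)
    = circ_occ_ending P T i.+1) ->
  online_circ_matching w A P T (size A) (static_space A).
Proof.
move=> A P0 hV lP lT e0 e1 g0 g1 ho [//|i] /andP[_ iT].
have PV : size P <= V by lia.
have TV : size T <= V by lia.
have [h1 _ _ _ h5] := run_correct P0 PV TV lP lT e0 e1 g0 g1 iT.
split; [exact: h1|exact/run_space/online_prog_direct|].
by rewrite h5 // ho.
Qed.

Lemma online_prog_matching S0 S1 :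
  (forall P T, 0 < size P ->
    [/\ forall i v, i <= size T -> env P T S0 i v <= 8 * (size P + size T),
        forall i v, i <= size T -> env P T S1 i v <= 8 * (size P + size T) &
        forall i, i < size T ->
          outs P (take i.+1 T) S0 (env P T S0 i) ++
          outs P (take i.+1 T) S1 (env P T S1 i) = circ_occ_ending P T i.+1]) ->
  exists (A : program) (time_bound space_bound : nat),
  forall alphabet_exp : nat,
  exists word_const : nat,
  forall (w sigma : nat) (P T : seq nat),
    let N := size P + size T in
    sigma <= N ^ alphabet_exp ->
    all (fun a => a < sigma) P ->
    all (fun a => a < sigma) T ->
    N ^ word_const <= 2 ^ w ->
    online_circ_matching w A P T time_bound space_bound.
Proof.
move=> H; set A := online_prog S0 S1.
exists A, (size A), (static_space A) => a.
exists (growth S0 + growth S1 + a + 6) => w sigma P T N hs hP hT hw.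
case: (posnP (size P)) => P0.
  by rewrite (size0nil P0); apply: online_prog_nil.
case: (posnP (size T)) => T0; first by move=> i; rewrite T0; lia.
have N2 : 1 < N by rewrite /N; lia.
have Nmono g : g <= growth S0 + growth S1 -> N ^ (g + a + 6) <= 2 ^ w.
  by move=> hg; apply: leq_trans hw; rewrite leq_exp2l // !leq_add2r.
have letters S : all (fun x => x < sigma) S -> all (fun x => x <= 8 * N + N ^ a) S.
  by move=> h; apply/allP => x /(allP h) hx; lia.
have [h1 h2 h3] := H P T P0.
apply: (@online_prog_correct w S0 S1 P T (8 * N + N ^ a)) => //.
- by rewrite -/N; lia.
- exact: letters.
- exact: letters.
- by move=> i v hi; apply: leq_trans (h1 i v hi) (leq_addr _ _).
- by move=> i v hi; apply: leq_trans (h2 i v hi) (leq_addr _ _).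
- by apply: word_size_bound => //; apply: Nmono; apply: leq_addr.
- by apply: word_size_bound => //; apply: Nmono; apply: leq_addl.
Qed.

Theorem theorem30 :
  exists (A : program) (time_bound space_bound : nat),
  forall alphabet_exp : nat,
  exists word_const : nat,
  forall (w sigma : nat) (P T : seq nat),
    let N := size P + size T in
    sigma <= N ^ alphabet_exp ->
    all (fun a => a < sigma) P ->
    all (fun a => a < sigma) T ->
    N ^ word_const <= 2 ^ w ->
    online_circ_matching w A P T time_bound space_bound.
Proof.
apply: (@online_prog_matching (bank 0) (bank 1)) => P T P0.
have envN k i v : k < 2 -> i <= size T ->
    env P T (bank k) i v <= 8 * (size P + size T).
  move=> k2 hi; case: (ltnP (size P) 8) => P8; first by rewrite env_bank_small.
  by have [h _] := slot_inv_env P8 k2 hi; apply: h.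
split; [by move=> i v; apply: envN|by move=> i v; apply: envN|move=> i hi].
case: (ltnP (size P) 8) => P8; last exact: outs_banks.
by rewrite !outs_bank_small // cats0 outs_brute // P0.
Qed.
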